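(* For any $\sqrt{\ln 2}<\beta<\sqrt{2\ln 2}$ and any small enough $\kappa>0$ (i.e. every $\kappa\in(0,\kappa_0)$ for some $\kappa_0=\kappa_0(\beta)>0$), there exist $P^*\in\mathbb{N}$, $0<\nu_1<\frac12\nu_2<\nu_2<1$ and $c,c'>0$ such that the following holds. For any integer $p\ge P^*$, the Gibbs measure $\mu_\beta$ of the Ising pure $p$-spin model is $(2\nu_1,\nu_2)$-shattered at inverse temperature $\beta$ (with constants $c,c'$). In particular, the clusters are a $(\nu_1,\nu_2)$-clustering of the set $$\bigl\{\boldsymbol{\sigma}\in\Sigma_n:\bigl|H(\boldsymbol{\sigma})-\beta\bigr|\le\kappa\sqrt{2\ln 2}\bigr\}.$$
   Context: For $n\in\mathbb{N}$, $\Sigma_n=\{-1,1\}^n$ and $d_H$ is the Hamming distance on $\Sigma_n$; ${\rm dist}(A,B)=\min_{x\in A,y\in B}d_H(x,y)$ and ${\rm diam}(A)=\max_{x,y\in A}d_H(x,y)$ for $A,B\subset\Sigma_n$. For a fixed integer $p\ge 2$, the Ising pure $p$-spin Hamiltonian is $$H(\boldsymbol{\sigma})=n^{-\frac{p+1}{2}}\sum_{1\le i_1,\dots,i_p\le n}J_{i_1,\dots,i_p}\boldsymbol{\sigma}_{i_1}\cdots\boldsymbol{\sigma}_{i_p},\qquad\boldsymbol{\sigma}\in\Sigma_n,$$ where $\boldsymbol{J}=(J_{i_1,\dots,i_p})_{1\le i_1,\dots,i_p\le n}$ has i.i.d. standard normal entries. For $\beta>0$ (the inverse temperature), the Gibbs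 measure is $\mu_\beta(A)=\frac{1}{Z_\beta}\sum_{\boldsymbol{\sigma}\in A}e^{\beta nH(\boldsymbol{\sigma})}$ for $A\subset\Sigma_n$, with $Z_\beta=\sum_{\boldsymbol{\sigma}\in\Sigma_n}e^{\beta nH(\boldsymbol{\sigma})}$. Shattering: the Gibbs measure is $(a,b)$-shattered at inverse temperature $\beta>0$ if there exist constants $c,c'>0$ such that with high probability (i.e. with probability tending to $1$) as $n\to\infty$ with respect to $\boldsymbol{J}$, there exist non-empty subsets $(\mathcal{C}_\ell)_{\ell=1}^L$ of $\Sigma_n$, called clusters, such that: (a) $\frac1n\log_2L\ge c$; (b) $\max_{1\le i\le L}{\rm diam}(\mathcal{C}_i)\le an$ and $\min_{1\le i<j\le L}{\rm dist}(\mathcal{C}_i,\mathcal{C}_j)\ge bn$; (c) $\max_{1\le i\le L}\mu_\beta(\mathcal{C}_i)\le\exp(-c'n)$; (d) $\mu_\beta\bigl(\cup_{1\le i\le L}\mathcal{C}_i\bigr)=1-o_n(1)$, where $o_n(1)\to0$ as $n\to\infty$. $(\nu_1,\nu_2)$-clustering: a collection $(\mathcal{C}_\ell)_{\ell=1}^L$ of subsets of $A\subseteq\Sigma_n$ is a $(\nu_1,\nu_2)$-clustering of $A$ if it is a partition of $A$ such that (i) for any $1\le i\le L$ and $\boldsymbol{\sigma},\boldsymbol{\sigma}'\in\mathcal{C}_i$, $d_H(\boldsymbol{\sigma},\boldsymbol{\sigma}')\le\nu_1n$; (ii) for any $1\le i<j\le L$, $\boldsymbol{\sigma}\in\mathcal{C}_i$,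 $\boldsymbol{\sigma}'\in\mathcal{C}_j$, $d_H(\boldsymbol{\sigma},\boldsymbol{\sigma}')\ge\nu_2n$. *)

(* Defs.v *)
From HB Require Import structures.
From mathcomp Require Import all_boot all_order all_algebra.
From mathcomp Require Import all_classical all_reals all_analysis.
Set Implicit Arguments.
Unset Strict Implicit.
Unset Printing Implicit Defensive.
Import Order.TTheory GRing.Theory Num.Theory.
Import numFieldNormedType.Exports.

Local Open Scope ring_scope.

Section hypercube.
Variable n : nat.

(* The cube {-1,1}^n: a configuration stores one sign bit per coordinate, and
   spin decodes false to 1 and true to -1. *)
Definition config := {ffun 'I_n -> bool}.

Definition spin (R : realType) (s : config) (i : 'I_n) : R := (-1) ^+ s i.

Definition hamming (s t : config) : nat := #|[pred i | s i != t i]|.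

Definition diam (A : {set config}) : nat :=
  \max_(s in A) \max_(t in A) hamming s t.

(* As hamming s t <= n, the initial value n does not affect the minimum when A
   and B are nonempty. *)
Definition dist (A B : {set config}) : nat :=
  \big[minn/n]_(s in A) \big[minn/n]_(t in B) hamming s t.

End hypercube.

Section gibbs.
Variables (R : realType) (n p : nat).

Definition hamiltonian (J : {ffun 'I_p -> 'I_n} -> R) (s : config n) : R :=
  n%:R `^ (- (p.+1%:R / 2)) *
  \sum_(i : {ffun 'I_p -> 'I_n}) J i * \prod_(k < p) spin R s (i k).

Definition partition_function (H : config n -> R) (beta : R) : R :=
  \sum_(s : config n) expR (beta * n%:R * H s).

Definition gibbs (H : config n -> R) (beta : R) (A : {set config n}) : R :=
  (partition_function H beta)^-1 * \sum_(s in A) expR (beta * n%:R * H s).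

End gibbs.

Section clusters.
Variables (R : realType) (n : nat).

(* A family (C_l) for 1 <= l <= L is a sequence of length L; pairwise ranges
   over the pairs of positions i < j. The number e bounds the Gibbs mass left
   outside the clusters. *)
Definition shattering (H : config n -> R) (beta a b c c' e : R)
    (C : seq {set config n}) : Prop :=
  [/\ forall A, A \in C -> A != finset.set0,
      n%:R^-1 * (ln (size C)%:R / ln 2) >= c,
      (forall A, A \in C -> (diam A)%:R <= a * n%:R) /\
      pairwise [rel A B | b * n%:R <= (dist A B)%:R] C,
      forall A, A \in C -> gibbs H beta A <= expR (- (c' * n%:R)) &
      1 - e <= gibbs H beta (\bigcup_(A <- C) A)%SET].

Definition clustering (nu1 nu2 : R) (S : {set config n})
    (C : seq {set config n}) : Prop :=
  [/\ uniq C /\ finset.partition [set A in C]%SET S,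
      forall A, A \in C ->
        forall s t, s \in A -> t \in A -> (hamming s t)%:R <= nu1 * n%:R &
      pairwise [rel A B : {set config n} | [forall s in A, forall t in B,
        nu2 * n%:R <= (hamming s t)%:R]] C].

Definition energy_window (H : config n -> R) (beta r : R) : {set config n} :=
  [set s | `|H s - beta| <= r]%SET.

End clusters.

Local Open Scope classical_set_scope.

Section probability.
Variables (R : realType) (d : measure_display) (T : measurableType d).
Variable P : probability T R.

Definition mutually_independent (I : finType) (X : I -> {RV P >-> R}) : Prop :=
  forall (S : {set I}) (B : I -> set R), (forall i, measurable (B i)) ->
  P (\bigcap_(i in [set` S]) (X i @^-1` B i)) =
  (\prod_(i in S) P (X i @^-1` B i))%E.

Definition iid_std_normal (I : finType) (X : I -> {RV P >-> R}) : Prop :=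
  mutually_independent X /\
  forall i (B : set R), measurable B ->
    distribution P (X i) B = normal_prob 0 1 B.

Definition with_high_probability (E : nat -> set T) : Prop :=
  (forall n, measurable (E n)) /\ P (E n) @[n --> \oo] --> 1%E.

(* The disorders J n need not be related for different n. The deterministic
   sequence eps is the o_n(1) of the shattering property, and the clusters may
   depend on the outcome w. The parameter K is an additional requirement on
   the same clusters; the shattering property itself is the case where K always
   holds. *)
Definition shattered_such_that (p : nat)
    (J : forall n, {ffun 'I_p -> 'I_n} -> {RV P >-> R}) (beta a b c c' : R)
    (K : forall n, (config n -> R) -> seq {set config n} -> Prop) : Prop :=
  exists2 eps : nat -> R, eps n @[n --> \oo] --> (0 : R) &
  with_high_probability (fun n => [set w |
    let H := hamiltonian (fun i => J n i w) in
    exists C : seq {set config n},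
      shattering H beta a b c c' (eps n) C /\ K n H C]).

End probability.

(* Main.v *)
Require Import Defs.
From HB Require Import structures.
From mathcomp Require Import all_boot all_order all_algebra.
From mathcomp Require Import all_classical all_reals all_analysis.
From mathcomp Require Import measurable_realfun ring lra.
Import Order.TTheory GRing.Theory Num.Theory.
Import numFieldNormedType.Exports.
(** For a fixed n the energies n * H(s) are centred Gaussian variables of
    variance n whose correlation is overlap(s, t) ^ p. For large p this
    correlation is negligible unless s and t are nearly equal or nearly
    opposite, so that the model behaves like independent energies: there are
    about exp(n (ln 2 - beta^2 / 2)) configurations of energy close to beta,
    they carry the Gibbs measure, and they sit far apart. Everything is derived
    from two exponential moments, those of l * n * H(s) and of
    l * n * (H(s) + H(t)); they follow from the product rule for independent
    events and the exponential moments of the standard normal law. Write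
    r = kappa * sqrt (2 ln 2) for the half-width of the energy window, M for
    the mean 2 ^ n * exp (n beta^2 / 2) of the partition function Z, and g for
    the smaller of beta^2 - ln 2 and ln 2 - beta^2 / 2.

    - Lower bound for Z. The plain second moment of Z is too large, because of
      the pairs s = t, as soon as beta^2 > ln 2. The contribution of energies
      above beta + r is therefore discarded. This hardly changes the mean, and
      for nearby (or nearly opposite) pairs the truncation brings the second
      moment down to exp (n (3 beta^2 / 2 + beta r)), where beta^2 < 2 ln 2 is
      exactly what makes it negligible (integral_trunc_pair_le_near). For all
      other pairs p is so large that n * beta^2 * overlap ^ p is at most
      n * overlap ^ 8 / 16, whose exponential moment over the uniform pairs is
      1 + O(1 / n) (sum_expR_overlap8_le). Chebyshev's inequality gives
      Z >= M / 2 with high probability (probability_trunc_partition_small).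

    - Mass of the window. The expected Boltzmann mass outside the window is at
      most 2 M exp (- n r^2 / 2), hence negligible (probability_tail_weight).

    - Gap in the distances. The expected number of pairs of the window at a
      distance between nu1 n and nu n is at most about
      2 ^ n * exp (g n / 8) * exp (- n (beta - r)^2), which is exponentially
      small since beta^2 > ln 2 (probability_close_pairs).

    Outside these three rare events, being at distance at most nu1 n is an
    equivalence relation on the window, and its classes are the clusters
    (shattering_of_gap). Each class lies in a Hamming ball with at most
    exp (g n / 8) points, so its Gibbs measure is at most
    2 exp (n (g / 8 + beta^2 / 2 + beta r - ln 2)) <= exp (- g n / 2) for large
    n, provided that beta r <= g / 4. Since together the classes carry at least
    half of the measure for large n, there are at least exp (g n / 4) of
    them. *)

Set Implicit Arguments.
Unset Strict Implicit.
Unset Printing Implicit Defensive.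
Local Open Scope ring_scope.

(** * Exponential moments of independent Gaussian variables *)

Section exponential_moments.
Import HBNNSimple.
Local Open Scope classical_set_scope.

(** If, for every B, the integral of g over the event that phi lies in B is
    c * nu B, then the image under phi of the measure with density g is c * nu,
    also as an integral. *)
Lemma ge0_integral_density_transfer d d' (T : measurableType d)
    (T' : measurableType d') (R : realType) (mu : {measure set T -> \bar R})
    (nu : {measure set T' -> \bar R}) (phi : T -> T') (g : T -> R)
    (c : R) (f : T' -> R) :
  measurable_fun setT phi -> measurable_fun setT g -> (forall x, 0 <= g x) ->
  0 <= c ->
  (forall B, measurable B ->
    (\int[mu]_x (g x * \1_B (phi x))%:E = c%:E * nu B)%E) ->
  measurable_fun setT f -> (forall y, 0 <= f y) ->
  (\int[mu]_x (g x * f (phi x))%:E = c%:E * \int[nu]_y (f y)%:E)%E.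
Proof.
move=> mphi mg g0 c0 H mf f0.
have mEf : measurable_fun setT (EFin \o f) by exact/measurable_EFinP.
pose f_ := nnsfun_approx measurableT mEf.
have f_cvg y : (f_ n y)%:E @[n --> \oo] --> (f y)%:E.
  by apply: cvg_nnsfun_approx => // z _; rewrite lee_fin.
have f_nd y : {homo (fun n => f_ n y) : m n / (m <= n)%N >-> m <= n}.
  by move=> m n mn; exact/lefP/nd_nnsfun_approx.
have mh (h : {nnsfun T' >-> R}) : measurable_fun setT (h \o phi).
  by apply: measurableT_comp.
have mind B : measurable B -> measurable_fun setT (fun x => \1_B (phi x) : R).
  by move=> mB; exact: (measurableT_comp (measurable_indic mB) mphi).
have mpre (h : {nnsfun T' >-> R}) k : measurable (h @^-1` [set k]).
  exact: measurable_funPTI.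
(* The identity for a simple function is a finite sum of the hypotheses. *)
have simple (h : {nnsfun T' >-> R}) :
    (\int[mu]_x (g x * h (phi x))%:E = c%:E * \int[nu]_y (h y)%:E)%E.
  transitivity (\sum_(k \in range h)
      \int[mu]_x (k * (g x * \1_(h @^-1` [set k]) (phi x)))%:E)%E.
    rewrite -ge0_integral_fsum//.
    - apply: eq_integral => x _; rewrite fsumEFin//; congr EFin.
      rewrite [in LHS](fimfunE h) mulr_fsumr; apply: eq_fsbigr => k _.
      by rewrite mulrCA.
    - move=> k; apply/measurable_EFinP; apply: measurable_funM => //.
      apply: measurable_funM => //; exact/mind/mpre.
    - move=> k x _; rewrite mulrCA EFinM mule_ge0 ?lee_fin// -lee_fin.
      exact: nnfun_muleindic_ge0.
  transitivity (\sum_(k \in range h)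
      (c%:E * \int[nu]_y (k * \1_(h @^-1` [set k]) y)%:E))%E.
    apply: eq_fsbigr => k; rewrite inE => -[y _ <-].
    under eq_integral do rewrite EFinM.
    rewrite ge0_integralZl_EFin//; last 2 first.
    - by move=> x _; rewrite lee_fin mulr_ge0.
    - by apply/measurable_EFinP; apply: measurable_funM => //; exact/mind/mpre.
    rewrite H// muleCA; congr (_ * _)%E.
    under eq_integral do rewrite EFinM.
    rewrite ge0_integralZl_EFin//; last exact/measurable_EFinP/measurable_indic.
    by rewrite integral_indic// setIT.
  rewrite -ge0_mule_fsumr; last first.
    by move=> k; apply: integral_ge0 => y _; exact: nnfun_muleindic_ge0.
  congr (_ * _)%E; rewrite -ge0_integral_fsum//.
  - apply: eq_integral => y _; rewrite fsumEFin//; congr EFin.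
    by rewrite [in RHS](fimfunE h).
  - by move=> k; apply/measurable_EFinP; apply: measurable_funM.
  - by move=> k y _; exact: nnfun_muleindic_ge0.
transitivity (limn (fun n => \int[mu]_x (g x * f_ n (phi x))%:E))%E.
  rewrite -monotone_convergence//.
  - apply: eq_integral => x _; apply/esym/cvg_lim => //.
    rewrite EFinM; under eq_fun do rewrite EFinM.
    by apply: cvgeZl.
  - by move=> n; apply/measurable_EFinP; apply: measurable_funM => //; exact: mh.
  - by move=> n x _; rewrite lee_fin mulr_ge0.
  - by move=> x _ m n mn; rewrite lee_fin ler_wpM2l//; exact: f_nd.
under eq_fun do rewrite simple.
have -> : (\int[nu]_y (f y)%:E = limn (fun n => \int[nu]_y (f_ n y)%:E))%E.
  rewrite -monotone_convergence//.
  - by apply: eq_integral => x _; apply/esym/cvg_lim.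
  - by move=> n; apply/measurable_EFinP.
  - by move=> n x _; rewrite lee_fin.
  - by move=> x _ m n mn; rewrite lee_fin; exact: f_nd.
rewrite limeMl//.
apply: ereal_nondecreasing_is_cvgn => m n mn; apply: ge0_le_integral => //.
- by move=> x _; rewrite lee_fin.
- by apply/measurable_EFinP.
- by apply/measurable_EFinP.
- by move=> x _; rewrite lee_fin; exact: f_nd.
Qed.

Lemma integral_expR_normal_prob (R : realType) (a : R) :
  (\int[normal_prob 0 1]_x (expR (a * x))%:E = (expR (a ^+ 2 / 2))%:E)%E.
Proof.
have mexp : measurable_fun setT (fun x : R => expR (a * x)).
  by apply: measurableT_comp => //; exact: measurable_funM.
(* exp (a x) times the standard density is exp (a^2 / 2) times the density of
   the normal law of mean a. *)
have := @ge0_integral_density_transfer _ _ _ _ R lebesgue_measure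
  (normal_prob (0 : R) 1) idfun (normal_pdf 0 1) 1 (fun x => expR (a * x)).
rewrite mul1e => <- //; last 4 first.
- exact: measurable_id.
- exact: measurable_normal_pdf.
- by move=> x; exact: normal_pdf_ge0.
- move=> B mB; rewrite mul1e /normal_prob [RHS]integral_mkcond.
  apply: eq_integral => x _; rewrite patchE.
  by case: ifPn => xB; rewrite ?mem_setE indicE ?xB ?mulr1 // (negbTE xB) mulr0.
rewrite -[RHS]mule1 -(@integral_normal_pdf R a 1) -ge0_integralZl_EFin//.
- apply: eq_integral => x _; rewrite -EFinM; congr EFin.
  rewrite !normal_pdfE ?oner_eq0// -mulrA [RHS]mulrCA; congr (_ * _).
  by rewrite /normal_fun -!expRD; congr expR; rewrite expr1n /=; field.
- by move=> x _; rewrite lee_fin normal_pdf_ge0.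
- by apply/measurable_EFinP; exact: measurable_normal_pdf.
Qed.

End exponential_moments.

Section gaussian_family.
Local Open Scope classical_set_scope.
Variables (R : realType) (d : measure_display) (T : measurableType d).
Variable P : probability T R.
Variables (I : finType) (X : I -> {RV P >-> R}).
Hypothesis iidX : iid_std_normal X.

Lemma measurable_prod_expR (a : I -> R) (s : seq I) :
  measurable_fun setT (fun w => \prod_(i <- s) expR (a i * X i w)).
Proof.
elim: s => [|j s ih].
  by under eq_fun do rewrite big_nil; exact: measurable_cst.
under eq_fun do rewrite big_cons.
apply: measurable_funM => //; apply: measurableT_comp => //.
exact: measurable_funM.
Qed.

(** Removing the exponential factors one index at a time: the events of the
    remaining indices are carried along, so that the induction hypothesis
    identifies the law of the next variable under the tilted measure. *)
Lemma integral_prod_expR_indic (a : I -> R) (s : seq I) (U : {set I})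
    (B : I -> set R) :
  uniq s -> (forall i, i \in s -> i \notin U) ->
  (forall i, measurable (B i)) ->
  (\int[P]_w ((\prod_(i <- s) expR (a i * X i w)) *
     \1_(\bigcap_(i in [set` U]) (X i @^-1` B i)) w)%:E =
   (\prod_(i <- s) expR (a i ^+ 2 / 2))%:E *
     P (\bigcap_(i in [set` U]) (X i @^-1` B i)))%E.
Proof.
have mcap (V : {set I}) (C : I -> set R) : (forall i, measurable (C i)) ->
    measurable (\bigcap_(i in [set` V]) (X i @^-1` C i)).
  move=> mC; apply: fin_bigcap_measurable; first exact: finite_finset.
  by move=> i _; exact: measurable_funPTI.
elim: s U B => [|j s ih] U B /=.
  move=> _ _ mB; rewrite big_nil mul1e.
  under eq_integral do rewrite big_nil mul1r.
  by rewrite integral_indic ?setIT//; exact: mcap.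
move=> /andP[js us] sU mB.
have jU : j \notin U by rewrite sU// mem_head.
set E := \bigcap_(i in [set` U]) _.
have mE : measurable E by exact: mcap.
pose c := (\prod_(i <- s) expR (a i ^+ 2 / 2)) * fine (P E).
have PE : (fine (P E))%:E = P E by rewrite fineK// fin_num_measure.
have mg : measurable_fun setT
    (fun w => (\prod_(i <- s) expR (a i * X i w)) * \1_E w).
  by apply: measurable_funM => //; exact: measurable_prod_expR.
have prod0 (b : I -> R) : 0 <= \prod_(i <- s) expR (b i).
  by apply: prodr_ge0 => i _; exact: expR_ge0.
have := @ge0_integral_density_transfer _ _ _ _ R P (normal_prob (0 : R) 1)
  (X j) _ c (fun x => expR (a j * x)) _ mg.
move=> tr.
transitivity (\int[P]_w ((\prod_(i <- s) expR (a i * X i w)) * \1_E w *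
    expR (a j * X j w))%:E)%E.
  by apply: eq_integral => w _; rewrite big_cons -mulrA mulrC.
rewrite tr//.
- rewrite integral_expR_normal_prob big_cons /c -PE -!EFinM; congr EFin.
  by rewrite mulrC mulrA.
- exact: (@measurable_funP _ _ _ _ _ (X j)).
- by move=> w; rewrite mulr_ge0.
- by rewrite /c mulr_ge0// fine_ge0// measure_ge0.
- move=> C mC.
  pose B' i := if i == j then C else B i.
  have mB' i : measurable (B' i) by rewrite /B'; case: ifPn => _; [exact: mC|exact: mB].
  have EU : \bigcap_(i in [set` U]) (X i @^-1` B' i) = E.
    apply: eq_bigcapr => i /= iU; rewrite /B'; case: ifPn => // /eqP ij.
    by rewrite ij (negbTE jU) in iU.
  have EjU : \bigcap_(i in [set` j |: U]%SET) (X i @^-1` B' i) =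
      (X j @^-1` C) `&` E.
    apply/seteqP; split => w /=.
      move=> h; split; first by have := h j; rewrite /= setU11 /B' eqxx; apply.
      by rewrite -EU => i /= iU; apply: h; rewrite /= in_setU1 iU orbT.
    rewrite -EU => -[h1 h2] i /=; rewrite in_setU1 => /orP[/eqP ->|iU].
      by rewrite /B' eqxx.
    exact: h2.
  transitivity (\int[P]_w ((\prod_(i <- s) expR (a i * X i w)) *
      \1_(\bigcap_(i in [set` j |: U]%SET) (X i @^-1` B' i)) w)%:E)%E.
    apply: eq_integral => w _; rewrite EjU indicI /= -mulrA; congr (_ * _)%:E.
    by rewrite mulrC.
  rewrite ih//; last first.
    move=> i si; rewrite !inE negb_or; apply/andP; split.
      by apply: contraNN js => /eqP <-.
    by apply: sU; rewrite inE si orbT.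
  have [ind dist] := iidX.
  rewrite ind// big_setU1//= {1}/B' eqxx /c EFinM -muleA; congr (_ * _)%E.
  rewrite PE [RHS]muleC -(dist j C mC); congr (_ * _)%E.
  by rewrite -ind// EU.
- by apply: measurableT_comp => //; exact: measurable_funM.
Qed.

Lemma integral_expR_linear_comb (a : I -> R) :
  (\int[P]_w (expR (\sum_i a i * X i w))%:E =
   (expR ((\sum_i a i ^+ 2) / 2))%:E)%E.
Proof.
have := @integral_prod_expR_indic a (index_enum I) finset.set0 (fun=> setT)
  (index_enum_uniq I).
move=> h.
transitivity (\int[P]_w ((\prod_(i <- index_enum I) expR (a i * X i w)) *
  \1_(\bigcap_(i in [set` (finset.set0 : {set I})]) (X i @^-1` setT)) w)%:E)%E.
  apply: eq_integral => w _; rewrite expR_sum; congr EFin.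
  by rewrite indicE mem_set ?mulr1.
rewrite h//; last by move=> i _; rewrite inE.
rewrite -expR_sum -mulr_suml.
rewrite (_ : \bigcap_(i in _) _ = setT) ?probability_setT ?mule1//.
by apply/seteqP; split.
Qed.

End gaussian_family.

(** * Overlaps and exponential moments of the Hamiltonian *)

Section overlap.
Variable R : realType.

(** The normalised scalar product of two configurations; for n = 0 it is 0. *)
Definition overlap n (s t : config n) : R :=
  n%:R^-1 * \sum_i spin R s i * spin R t i.

Lemma spin_mul n (s t : config n) i :
  spin R s i * spin R t i = 1 - 2 * (s i != t i)%:R.
Proof. by rewrite /spin; case: (s i); case: (t i); rewrite /= ?expr0 ?expr1; ring. Qed.

Lemma hamming_sum n (s t : config n) : hamming s t = (\sum_i (s i != t i))%N.
Proof. by rewrite /hamming -sum1_card big_mkcond. Qed.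

Lemma hamming_le n (s t : config n) : (hamming s t <= n)%N.
Proof. by rewrite -[leqRHS](card_ord n) max_card. Qed.

Lemma hammingC n (s t : config n) : hamming s t = hamming t s.
Proof. by rewrite !hamming_sum; apply: eq_bigr => i _; rewrite eq_sym. Qed.

Lemma hammingss n (s : config n) : hamming s s = 0%N.
Proof. by rewrite hamming_sum big1// => i _; rewrite eqxx. Qed.

Lemma hamming_triangle n (s t u : config n) :
  (hamming s u <= hamming s t + hamming t u)%N.
Proof.
rewrite !hamming_sum -big_split/=; apply: leq_sum => i _.
by case: (s i); case: (t i); case: (u i).
Qed.

Lemma overlapE n (s t : config n) : (0 < n)%N ->
  overlap s t = 1 - 2 * (n%:R^-1 * (hamming s t)%:R).
Proof.
move=> n0; have nn : n%:R != 0 :> R by rewrite pnatr_eq0 -lt0n.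
rewrite /overlap (eq_bigr _ (fun i _ => spin_mul s t i)) sumrB sumr_const card_ord.
rewrite -mulr_sumr -natr_sum -hamming_sum mulrBr mulVf//.
by rewrite mulrCA.
Qed.

Lemma overlapss n (s : config n) : (0 < n)%N -> overlap s s = 1.
Proof. by move=> n0; rewrite overlapE// hammingss !mulr0 subr0. Qed.

Lemma normr_1B2_le1 n k : (0 < n)%N -> (k <= n)%N ->
  `|1 - 2 * (n%:R^-1 * k%:R)| <= 1 :> R.
Proof.
move=> n0 kn.
have : 0 <= (n%:R^-1 : R) * k%:R <= 1.
  by rewrite mulr_ge0 ?invr_ge0//= mulrC ler_pdivrMr ?ltr0n// mul1r ler_nat.
by move=> h; rewrite ler_norml; lra.
Qed.

Lemma overlap_le1 n (s t : config n) : (0 < n)%N -> `|overlap s t| <= 1.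
Proof. by move=> n0; rewrite overlapE//; exact/normr_1B2_le1/hamming_le. Qed.

Lemma sum_prod_spin n p (s t : config n) : (0 < n)%N ->
  \sum_(i : {ffun 'I_p -> 'I_n})
    (\prod_(k < p) spin R s (i k)) * (\prod_(k < p) spin R t (i k)) =
  n%:R ^+ p * overlap s t ^+ p.
Proof.
move=> n0; have nn : n%:R != 0 :> R by rewrite pnatr_eq0 -lt0n.
rewrite /overlap exprMn mulrA -exprMn divff// expr1n mul1r.
rewrite -[in RHS](card_ord p) -prodr_const bigA_distr_bigA/=.
by apply: eq_bigr => i _; rewrite big_split.
Qed.

Lemma powR_half_sqr n p : (0 < n)%N ->
  (n%:R `^ (- (p.+1%:R / 2)) : R) ^+ 2 = (n%:R ^+ p.+1)^-1.
Proof.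
move=> n0; rewrite -powR_mulrn ?powR_ge0// -powRrM mulNr divfK//.
by rewrite powRN powR_mulrn.
Qed.

End overlap.

Section hamiltonian_moments.
Local Open Scope classical_set_scope.
Variables (R : realType) (d : measure_display) (T : measurableType d).
Variable P : probability T R.
Variables (n p : nat) (J : {ffun 'I_p -> 'I_n} -> {RV P >-> R}).
Hypothesis n0 : (0 < n)%N.
Hypothesis iidJ : iid_std_normal J.
Local Notation H w := (hamiltonian (fun i => J i w)).

Lemma measurable_hamiltonian (s : config n) : measurable_fun setT (fun w => H w s).
Proof.
rewrite /hamiltonian; apply: measurable_funM => //.
apply: measurable_sum => i; exact: measurable_funM.
Qed.

(** Both energies have variance 1 / n and their covariance is
    overlap ^ p / n. *)
Lemma integral_expR_hamiltonian_pair (l : R) (s t : config n) :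
  (\int[P]_w (expR (l * n%:R * (H w s + H w t)))%:E =
   (expR (l ^+ 2 * n%:R * (1 + overlap R s t ^+ p)))%:E)%E.
Proof.
pose e u (i : {ffun 'I_p -> 'I_n}) : R := \prod_(k < p) spin R u (i k).
pose a i := l * n%:R * n%:R `^ (- (p.+1%:R / 2)) * (e s i + e t i).
have := integral_expR_linear_comb iidJ a.
have -> : (\sum_i a i ^+ 2) / 2 = l ^+ 2 * n%:R * (1 + overlap R s t ^+ p).
  have nn : n%:R != 0 :> R by rewrite pnatr_eq0 -lt0n.
  rewrite /a; under eq_bigr do rewrite exprMn.
  rewrite -mulr_sumr 2!exprMn powR_half_sqr//.
  have -> : \sum_i (e s i + e t i) ^+ 2 =
      n%:R ^+ p * (2 + 2 * overlap R s t ^+ p).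
    have ee u v : \sum_i e u i * e v i = n%:R ^+ p * overlap R u v ^+ p.
      exact: sum_prod_spin.
    transitivity (\sum_i (e s i * e s i + 2 * (e s i * e t i) + e t i * e t i)).
      by apply: eq_bigr => i _; ring.
    rewrite !big_split/= -mulr_sumr !ee !overlapss// expr1n; ring.
  rewrite [n%:R ^+ p.+1]exprS; field.
  by rewrite nn expf_neq0.
move=> <-; apply: eq_integral => w _; congr (expR _)%:E.
rewrite /hamiltonian -mulrDr mulrA -big_split/= mulr_sumr.
by apply: eq_bigr => i _; rewrite /a /e; ring.
Qed.

Lemma integral_expR_hamiltonian (l : R) (s : config n) :
  (\int[P]_w (expR (l * n%:R * H w s))%:E =
   (expR (l ^+ 2 * n%:R / 2))%:E)%E.
Proof.
transitivity (\int[P]_w (expR (l / 2 * n%:R * (H w s + H w s)))%:E)%E.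
  by apply: eq_integral => w _; congr (expR _)%:E; field.
rewrite integral_expR_hamiltonian_pair overlapss// expr1n.
by congr (expR _)%:E; field.
Qed.

End hamiltonian_moments.

(** * Counting configurations by their distance to a given one *)

Section counting.
Variable R : realType.

(** The coordinates of a uniformly random configuration are independent. *)
Lemma sum_prod_neq n (s : config n) (f : bool -> R) :
  \sum_(t : config n) \prod_i f (s i != t i) = (f true + f false) ^+ n.
Proof.
rewrite -(bigA_distr_bigA (fun i b => f (s i != b)))/=.
rewrite -[in RHS](card_ord n) -prodr_const; apply: eq_bigr => i _.
by rewrite big_bool; case: (s i) => //=; rewrite addrC.
Qed.

Lemma expR_le_inv1B (x : R) : x < 1 -> expR x <= (1 - x)^-1.
Proof.
move=> x1; rewrite -[leRHS]mul1r ler_pdivlMr ?subr_gt0//.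
rewrite -[leRHS](mulfV (lt0r_neq0 (expR_gt0 x))) ler_pM2l ?expR_gt0//.
by rewrite -expRN; exact: expR_ge1Dx.
Qed.

Lemma expRD_expRN_le (x : R) : `|x| <= 2^-1 ->
  expR x + expR (- x) <= 2 * expR (2 * x ^+ 2).
Proof.
rewrite ler_norml => /andP[x1 x2].
have h1 : expR x <= (1 - x)^-1 by apply: expR_le_inv1B; lra.
have h2 : expR (- x) <= (1 + x)^-1.
  by rewrite -[in leRHS](opprK x); apply: expR_le_inv1B; lra.
have h3 : 1 + 2 * x ^+ 2 <= expR (2 * x ^+ 2) by exact: expR_ge1Dx.
have h4 : (1 - x)^-1 + (1 + x)^-1 <= 2 * (1 + 2 * x ^+ 2).
  rewrite -subr_ge0.
  have -> : 2 * (1 + 2 * x ^+ 2) - ((1 - x)^-1 + (1 + x)^-1) =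
      2 * x ^+ 2 * (1 - 2 * x ^+ 2) * ((1 - x)^-1 * (1 + x)^-1).
    by field; apply/andP; split; lra.
  rewrite mulr_ge0//; last by rewrite mulr_ge0// invr_ge0; lra.
  by rewrite mulr_ge0//; nra.
lra.
Qed.

(** Chernoff bound for a statistic h whose distribution over the cube is
    binomial, with the exponent tau = 2 / psi: then tau * psi ^ 2 / 4 = psi / 2,
    and expR (- tau) <= psi / 2. *)
Lemma card_le_expR n (h : config n -> nat) (psi : R) :
  0 < psi ->
  (forall tau : R, \sum_t expR (- tau * (h t)%:R) = (1 + expR (- tau)) ^+ n) ->
  #|[pred t | (h t)%:R <= psi ^+ 2 / 4 * n%:R]|%:R <= expR (psi * n%:R).
Proof.
move=> psi0 H; pose tau := 2 / psi.
have tau0 : 0 < tau by rewrite divr_gt0.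
have e1 : (1 + expR (- tau)) ^+ n <= expR (psi / 2 * n%:R).
  rewrite mulrC expRM_natl lerXn2r ?nnegrE ?addr_ge0 ?expR_ge0//.
  apply: le_trans (expR_ge1Dx _); rewrite lerD2l expRN.
  rewrite -[psi / 2]invrK invf_div lef_pV2 ?posrE ?expR_gt0 ?divr_gt0//.
  by apply: le_trans (expR_ge1Dx _); rewrite lerDr.
rewrite [X in expR (X * _)](_ : psi = psi / 2 + psi / 2); last by field.
rewrite mulrDl expRD -ler_pdivrMl ?expR_gt0//.
apply: le_trans e1; rewrite -H -expRN -sum1_card natr_sum mulr_sumr.
rewrite big_mkcond/=; apply: ler_sum => t _; case: ifPn => [|_]; last exact: expR_ge0.
rewrite inE => ht; rewrite mulr1 ler_expR.
rewrite mulNr lerN2.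
have -> : psi / 2 * n%:R = tau * (psi ^+ 2 / 4 * n%:R).
  by rewrite /tau; field; rewrite gt_eqF.
by rewrite ler_pM2l.
Qed.

Lemma card_hamming_ball n (s : config n) (psi : R) : 0 < psi ->
  #|[pred t | (hamming s t)%:R <= psi ^+ 2 / 4 * n%:R]|%:R <= expR (psi * n%:R).
Proof.
move=> psi0; apply: card_le_expR => // tau.
have := sum_prod_neq s (fun b : bool => if b then expR (- tau) else 1 : R).
rewrite addrC => <-; apply: eq_bigr => t _.
rewrite hamming_sum natr_sum mulr_sumr expR_sum; apply: eq_bigr => i _.
by case: (s i != t i); rewrite ?mulr1// mulr0 expR0.
Qed.

Lemma card_hamming_antiball n (s : config n) (psi : R) : 0 < psi ->
  #|[pred t | (n - hamming s t)%:R <= psi ^+ 2 / 4 * n%:R]|%:R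
    <= expR (psi * n%:R).
Proof.
move=> psi0; apply: (@card_le_expR _ (fun t => (n - hamming s t)%N)) => // tau.
have := sum_prod_neq s (fun b : bool => if b then 1 : R else expR (- tau)).
move=> <-; apply: eq_bigr => t _.
have -> : (n - hamming s t)%N = (\sum_i (s i == t i))%N.
  rewrite hamming_sum -{1}(card_ord n) -sum1_card.
  rewrite [X in (X - _)%N](_ : _ = \sum_i (s i == t i) + \sum_i (s i != t i))%N.
    by rewrite addnK.
  by rewrite -big_split/=; apply: eq_bigr => i _; case: (s i == t i).
rewrite natr_sum mulr_sumr expR_sum; apply: eq_bigr => i _.
by case: (s i == t i); rewrite ?mulr1// mulr0 expR0.
Qed.

Lemma sum_expR_overlap n (s : config n) (l : R) : (0 < n)%N ->
  \sum_t expR (l * (n%:R * overlap R s t)) = (expR l + expR (- l)) ^+ n.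
Proof.
move=> n0; have nn : n%:R != 0 :> R by rewrite pnatr_eq0 -lt0n.
have := sum_prod_neq s (fun b : bool => expR (if b then - l else l)).
rewrite addrC => <-; apply: eq_bigr => t _.
rewrite /overlap mulVKf// mulr_sumr expR_sum; apply: eq_bigr => i _.
by rewrite spin_mul; case: (s i != t i) => /=; congr expR; ring.
Qed.

(** The Chernoff exponent is a quarter of the overlap rho of the points of the
    sphere; the sign of rho is immaterial. *)
Lemma card_hamming_sphere n (s : config n) (k : nat) : (0 < n)%N -> (k <= n)%N ->
  #|[pred t | hamming s t == k]|%:R <=
  2 ^+ n * expR (- (n%:R * (1 - 2 * (n%:R^-1 * k%:R)) ^+ 2 / 8)) :> R.
Proof.
move=> n0 kn; set rho := 1 - _.
have rho1 : `|rho| <= 1 by exact: normr_1B2_le1.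
have l1 : `|rho / 4| <= 2^-1 :> R.
  by rewrite normrM (ger0_norm (_ : 0 <= 4^-1))//; lra.
have := @lerXn2r R n _ _ _ _ (expRD_expRN_le l1).
rewrite !nnegrE addr_ge0 ?expR_ge0// mulr_ge0 ?expR_ge0// => /(_ isT isT).
rewrite -(sum_expR_overlap s)// exprMn -expRM_natl => h.
rewrite -(ler_pM2r (expR_gt0 (rho / 4 * (n%:R * rho)))).
apply: le_trans (le_trans _ h) _.
  rewrite -sum1_card natr_sum mulr_suml big_mkcond/=; apply: ler_sum => t _.
  case: ifPn => [|_]; last exact: expR_ge0.
  by rewrite inE => /eqP tk; rewrite overlapE// tk mul1r.
rewrite -[leRHS]mulrA ler_pM2l ?exprn_gt0// -expRD ler_expR.
by rewrite le_eqVlt; apply/orP; left; apply/eqP; field.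
Qed.

(** The typical overlap is of order n^(-1/2), so that n * overlap ^ 8 is
    negligible there; larger overlaps are exponentially rare. *)
Lemma sum_expR_overlap8_le : exists2 C : R, 0 < C & forall n (s : config n),
  (0 < n)%N ->
  \sum_t expR (n%:R * overlap R s t ^+ 8 / 16) <= 2 ^+ n * (1 + C / n%:R).
Proof.
(* K comes from x ^ 4 / 4! <= expR x at x = sqrt n / 16. *)
pose K : R := 16 ^+ 4 * 24.
have K0 : 0 < K by rewrite /K; lra.
exists (1 + 2 * K); first lra.
move=> n s n0.
have nn : 0 < n%:R :> R by rewrite ltr0n.
have n1 : 1 <= n%:R :> R by rewrite ler1n.
rewrite (bigID (fun t => n%:R * overlap R s t ^+ 4 <= 1))/=.
have -> : 2 ^+ n * (1 + (1 + 2 * K) / n%:R) =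
    2 ^+ n * (1 + n%:R^-1) + 2 ^+ n * (2 * K / n%:R) :> R.
  by field; rewrite gt_eqF.
apply: lerD.
  apply: (@le_trans _ _ (\sum_(t : config n) (1 + n%:R^-1))).
    rewrite big_mkcond/=; apply: ler_sum => t _.
    case: ifPn => [h|_]; last by rewrite addr_ge0// invr_ge0 ltW.
    have a0 : 0 <= n%:R * overlap R s t ^+ 4.
      by apply: mulr_ge0; [exact: ltW|exact: exprn_even_ge0].
    have le1 : n%:R * overlap R s t ^+ 8 / 16 <= n%:R^-1 / 16.
      rewrite ler_pM2r//.
      have -> : n%:R * overlap R s t ^+ 8 = n%:R^-1 * (n%:R * overlap R s t ^+ 4) ^+ 2.
        by field; rewrite gt_eqF.
      rewrite ler_piMr// ?invr_ge0 ?(ltW nn)//.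
      by rewrite expr_le1.
    have i0 : 0 < n%:R^-1 :> R by rewrite invr_gt0.
    have i1 : n%:R^-1 <= 1 :> R by rewrite invf_le1.
    apply: (@le_trans _ _ (expR (n%:R^-1 / 16))); first by rewrite ler_expR.
    apply: le_trans (expR_le_inv1B _) _; first lra.
    rewrite -[leLHS]mul1r ler_pdivrMr; last lra.
    by nra.
  rewrite sumr_const card_ffun card_bool card_ord.
  by rewrite -[leLHS]mulr_natl natrX.
(* For large overlaps the sum is taken sphere by sphere. *)
pose D t := inord (hamming s t) : 'I_n.+1.
have DE t : D t = hamming s t :> nat by rewrite inordK// ltnS hamming_le.
rewrite (partition_big D xpredT)//=.
apply: (@le_trans _ _ (\sum_(k < n.+1) 2 ^+ n * expR (- (Num.sqrt n%:R / 16)))).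
  apply: ler_sum => k _.
  pose rho : R := 1 - 2 * (n%:R^-1 * k%:R).
  have rhoE t : D t = k -> overlap R s t = rho.
    by move=> tk; rewrite overlapE// -DE tk.
  have [h|h] := leP (n%:R * rho ^+ 4) 1.
    rewrite big_pred0 ?mulr_ge0 ?exprn_ge0 ?expR_ge0// => t.
    by apply/negbTE; apply/negP => /andP[+ /eqP/rhoE tk]; rewrite tk h.
  have sq : Num.sqrt n%:R <= n%:R * rho ^+ 2.
    rewrite -(@ler_pXn2r _ 2)// ?nnegrE ?sqrtr_ge0//; last first.
      by apply: mulr_ge0; [exact: ltW|exact: sqr_ge0].
    rewrite sqr_sqrtr ?(ltW nn)//.
    have -> : (n%:R * rho ^+ 2) ^+ 2 = n%:R * (n%:R * rho ^+ 4) by ring.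
    by rewrite ler_pMr// ltW.
  have rho1 : rho ^+ 8 <= rho ^+ 2.
    have : `|rho| <= 1 by apply: normr_1B2_le1 => //; rewrite -ltnS.
    move=> r1; rewrite (_ : rho ^+ 8 = rho ^+ 2 * (rho ^+ 6)); last by ring.
    rewrite ler_piMr ?sqr_ge0//.
    by rewrite -[rho ^+ 6]ger0_norm ?exprn_even_ge0// normrX exprn_ile1.
  apply: (@le_trans _ _ (\sum_(t | hamming s t == k) expR (n%:R * rho ^+ 2 / 16))).
    rewrite [leLHS]big_mkcond [leRHS]big_mkcond/=. apply: ler_sum => t _.
    case: ifPn => [/andP[_ /eqP tk]|_]; last by case: ifP => // _; exact: expR_ge0.
    rewrite (rhoE _ tk) -DE tk eqxx ler_expR ler_pM2r//.
    by rewrite ler_pM2l.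
  rewrite sumr_const -[leLHS]mulr_natl.
  apply: (le_trans (ler_wpM2r (expR_ge0 _) (card_hamming_sphere _ n0 _))).
    by rewrite -ltnS.
  rewrite -[leLHS]mulrA ler_pM2l ?exprn_gt0// -expRD ler_expR -/rho; lra.
rewrite sumr_const card_ord -[leLHS]mulr_natl mulrCA ler_pM2l ?exprn_gt0//.
have K4 : n%:R ^+ 2 / K <= expR (Num.sqrt n%:R / 16).
  have x0 : 0 <= Num.sqrt n%:R / 16 :> R by rewrite mulr_ge0 ?sqrtr_ge0.
  have := @expR_ge1Dxn R (Num.sqrt n%:R / 16) 3 x0.
  apply: le_trans; rewrite exprMn -[4%N]/(2 * 2)%N exprM sqr_sqrtr ?(ltW nn)//.
  rewrite [X in X <= _](_ : _ = n%:R ^+ 2 * 16^-1 ^+ 4 / 24); last first.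
    by rewrite /K; field.
  by rewrite /factorial /= lerDr.
rewrite expRN ler_pdivrMr ?expR_gt0//.
apply: (@le_trans _ _ (2 * K / n%:R * (n%:R ^+ 2 / K))); last first.
  by rewrite ler_pM2l// divr_gt0// mulr_gt0.
rewrite [leRHS](_ : _ = n%:R + n%:R); last by field; rewrite !gt_eqF.
by rewrite -[n.+1]addn1 natrD lerD2l.
Qed.

End counting.

(** * Integrals and probabilities of nonnegative functions *)

Section integral_bounds.
Local Open Scope classical_set_scope.
Variables (R : realType) (d : measure_display) (T : measurableType d).
Variable P : probability T R.
Implicit Types f g : T -> R.

Lemma ler_integral f g : measurable_fun setT f -> measurable_fun setT g ->
  (forall w, 0 <= f w) -> (forall w, f w <= g w) ->
  (\int[P]_w (f w)%:E <= \int[P]_w (g w)%:E)%E.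
Proof.
move=> mf mg f0 fg; apply: ge0_le_integral => //.
- by move=> w _; rewrite lee_fin.
- exact/measurable_EFinP.
- exact/measurable_EFinP.
- by move=> w _; rewrite lee_fin.
Qed.

Lemma integral_sum_EFin (I : finType) (F : I -> T -> R) :
  (forall i, measurable_fun setT (F i)) -> (forall i w, 0 <= F i w) ->
  (\int[P]_w (\sum_i F i w)%:E = \sum_i \int[P]_w (F i w)%:E)%E.
Proof.
move=> mF F0; under eq_integral do rewrite -sumEFin.
rewrite ge0_integral_sum//; last by move=> i w _; rewrite lee_fin.
by move=> i; exact/measurable_EFinP.
Qed.

Lemma integral_mulr_EFin f k : measurable_fun setT f -> (forall w, 0 <= f w) ->
  0 <= k -> (\int[P]_w (k * f w)%:E = k%:E * \int[P]_w (f w)%:E)%E.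
Proof.
move=> mf f0 k0; under eq_integral do rewrite EFinM.
rewrite ge0_integralZl_EFin//; last exact/measurable_EFinP.
by move=> w _; rewrite lee_fin.
Qed.

Lemma integral_add_EFin f g : measurable_fun setT f -> measurable_fun setT g ->
  (forall w, 0 <= f w) -> (forall w, 0 <= g w) ->
  (\int[P]_w (f w + g w)%:E = \int[P]_w (f w)%:E + \int[P]_w (g w)%:E)%E.
Proof.
move=> mf mg f0 g0; under eq_integral do rewrite EFinD.
by rewrite ge0_integralD//; first [exact/measurable_EFinP|
  move=> w _; rewrite lee_fin].
Qed.

Lemma integral_cst_EFin k : (\int[P]_w k%:E = k%:E)%E.
Proof. by rewrite integral_cst//= probability_setT mule1. Qed.

Lemma probability_le_integral (A : set T) f : measurable A ->
  measurable_fun setT f -> (forall w, 0 <= f w) -> (forall w, A w -> 1 <= f w) ->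
  (P A <= \int[P]_w (f w)%:E)%E.
Proof.
move=> mA mf f0 f1; rewrite -[A in P A](setIT A) -integral_indic//.
apply: (@ler_integral (\1_A)) => // w.
rewrite indicE; case: (boolP (w \in A)) => [|_] //.
by rewrite inE => /f1.
Qed.

(** Chebyshev's inequality around a deterministic value M, which only needs to
    be an approximation of the mean. *)
Lemma probability_lt_half f (M a b : R) : measurable_fun setT f ->
  (forall w, 0 <= f w) -> 0 < M ->
  (M%:E <= \int[P]_w (f w)%:E + (M * a)%:E)%E ->
  (\int[P]_w (f w ^+ 2)%:E <= (M ^+ 2 * (1 + b))%:E)%E ->
  (P [set w | f w < M / 2]%R <= (4 * (b + 2 * a))%:E)%E.
Proof.
move=> mf f0 M0 h1 h2.
have mset : measurable [set w | f w < M / 2].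
  have := measurable_fun_ltr mf (@measurable_cst _ _ T _ setT (M / 2)).
  move=> /(_ measurableT [set true]); rewrite setTI; exact.
have mq : measurable_fun setT (fun w => (f w - M) ^+ 2).
  by apply: measurable_funX; exact: measurable_funB.
have mf2 : measurable_fun setT (fun w => f w ^+ 2) by exact: measurable_funX.
have E : (\int[P]_w ((f w - M) ^+ 2)%:E + (2 * M)%:E * \int[P]_w (f w)%:E =
          \int[P]_w (f w ^+ 2)%:E + (M ^+ 2)%:E)%E.
  rewrite -integral_mulr_EFin//; last by rewrite mulr_ge0// ltW.
  rewrite -integral_add_EFin//; last 3 first.
  - exact: measurable_funM.
  - by move=> w; exact: sqr_ge0.
  - by move=> w; rewrite !mulr_ge0// ltW.
  rewrite -[(M ^+ 2)%:E in RHS]integral_cst_EFin -integral_add_EFin//; last 2 first.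
  - by move=> w; exact: sqr_ge0.
  - by move=> w; exact: sqr_ge0.
  by apply: eq_integral => w _; congr EFin; ring.
have V : (\int[P]_w ((f w - M) ^+ 2)%:E <= (M ^+ 2 * (b + 2 * a))%:E)%E.
  have : (\int[P]_w ((f w - M) ^+ 2)%:E + (2 * M)%:E * (M * (1 - a))%:E <=
      (M ^+ 2 * (1 + b))%:E + (M ^+ 2)%:E)%E.
    apply: (@le_trans _ _ (\int[P]_w (f w ^+ 2)%:E + (M ^+ 2)%:E)%E).
      rewrite -E leeD2l// lee_wpmul2l//; first by rewrite lee_fin mulr_ge0// ltW.
      have -> : M * (1 - a) = M - M * a by ring.
      by rewrite EFinB leeBlDr.
    by rewrite leeD2r.
  rewrite -EFinM -EFinD -leeBrDr// -EFinB => /le_trans; apply.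
  by rewrite lee_fin le_eqVlt; apply/orP; left; apply/eqP; ring.
apply: (@le_trans _ _ (\int[P]_w (4 / M ^+ 2 * (f w - M) ^+ 2)%:E)%E).
  apply: probability_le_integral => //.
  - exact: measurable_funM.
  - by move=> w; rewrite mulr_ge0 ?sqr_ge0// divr_ge0// sqr_ge0.
  - move=> w /= fM; rewrite mulrAC ler_pdivlMr ?exprn_gt0// mul1r.
    have : 0 <= (M / 2 - f w) * (3 * M / 2 - f w).
      by rewrite mulr_ge0//; have := f0 w; lra.
    move=> h; rewrite -subr_ge0.
    have -> : 4 * (f w - M) ^+ 2 - M ^+ 2 =
        4 * ((M / 2 - f w) * (3 * M / 2 - f w)) by field.
    exact: mulr_ge0.
rewrite integral_mulr_EFin//; last 2 first.
- by move=> w; exact: sqr_ge0.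
- by rewrite divr_ge0// sqr_ge0.
apply: le_trans (lee_wpmul2l _ V) _; first by rewrite lee_fin divr_ge0// sqr_ge0.
rewrite -EFinM lee_fin le_eqVlt; apply/orP; left; apply/eqP; field.
by rewrite gt_eqF.
Qed.

End integral_bounds.

(** * Truncated partition function *)

Section measurable_comparison.
Local Open Scope classical_set_scope.
Variables (R : realType) (d : measure_display) (T : measurableType d).
Implicit Types f g : T -> R.

Lemma measurable_set_le f g : measurable_fun setT f -> measurable_fun setT g ->
  measurable [set w | f w <= g w].
Proof.
move=> mf mg; have := measurable_fun_ler mf mg.
by move=> /(_ measurableT [set true]); rewrite setTI; exact.
Qed.

Lemma measurable_set_lt f g : measurable_fun setT f -> measurable_fun setT g ->
  measurable [set w | f w < g w].
Proof.
move=> mf mg; have := measurable_fun_ltr mf mg.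
by move=> /(_ measurableT [set true]); rewrite setTI; exact.
Qed.

Lemma measurable_le_indic f (E : R) : measurable_fun setT f ->
  measurable_fun setT (fun w => (f w <= E)%R%:R : R).
Proof.
move=> mf; have mA := measurable_set_le mf (@measurable_cst _ _ T _ setT E).
rewrite (_ : (fun w => _) = \1_[set w | f w <= E]); first exact: measurable_indic.
by apply/funext => w; rewrite indicE; congr (nat_of_bool _)%:R; apply/idP/idP;
  rewrite inE.
Qed.

End measurable_comparison.

Section truncated_partition_function.
Local Open Scope classical_set_scope.
Variables (R : realType) (d : measure_display) (T : measurableType d).
Variable P : probability T R.
Variables (n p : nat) (J : {ffun 'I_p -> 'I_n} -> {RV P >-> R}).
Hypothesis n0 : (0 < n)%N.
Hypothesis iidJ : iid_std_normal J.
Local Notation H w := (hamiltonian (fun i => J i w)).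
Variables beta r : R.
Hypotheses (beta0 : 0 < beta) (r0 : 0 < r).

(** The Boltzmann weight of a configuration, set to 0 when its energy exceeds
    beta + r. *)
Definition trunc_weight (h : config n -> R) (s : config n) : R :=
  expR (beta * n%:R * h s) * (h s <= beta + r)%R%:R.

(** The sum of the truncated weights. *)
Definition trunc_partition (h : config n -> R) : R := \sum_s trunc_weight h s.

(** The mean of the partition function. *)
Definition annealed : R := 2 ^+ n * expR (n%:R * beta ^+ 2 / 2).

Lemma annealed_gt0 : 0 < annealed.
Proof. by rewrite mulr_gt0 ?exprn_gt0 ?expR_gt0. Qed.

Lemma trunc_weight_ge0 h s : 0 <= trunc_weight h s.
Proof. by rewrite mulr_ge0 ?expR_ge0. Qed.

Lemma trunc_partition_ge0 h : 0 <= trunc_partition h.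
Proof. by apply: sumr_ge0 => s _; exact: trunc_weight_ge0. Qed.

Lemma trunc_partition_le h : trunc_partition h <= partition_function h beta.
Proof.
by apply: ler_sum => s _; rewrite ler_piMr ?expR_ge0// lern1 leq_b1.
Qed.

Lemma measurable_expR_hamiltonian (l : R) s :
  measurable_fun setT (fun w => expR (l * n%:R * H w s)).
Proof.
apply: measurableT_comp => //; apply: measurable_funM => //.
exact: measurable_hamiltonian.
Qed.

Lemma measurable_expR_hamiltonian_pair (l : R) s t :
  measurable_fun setT (fun w => expR (l * n%:R * (H w s + H w t))).
Proof.
apply: measurableT_comp => //; apply: measurable_funM => //.
by apply: measurable_funD => //; exact: measurable_hamiltonian.
Qed.

Lemma measurable_trunc_weight s :
  measurable_fun setT (fun w => trunc_weight (H w) s).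
Proof.
apply: measurable_funM; first exact: measurable_expR_hamiltonian.
exact/measurable_le_indic/measurable_hamiltonian.
Qed.

Lemma measurable_trunc_partition :
  measurable_fun setT (fun w => trunc_partition (H w)).
Proof. by apply: measurable_sum => s; exact: measurable_trunc_weight. Qed.

Lemma sum_config_cst (k : R) : \sum_(s : config n) k = 2 ^+ n * k.
Proof. by rewrite sumr_const card_ffun card_bool card_ord -[LHS]mulr_natl natrX. Qed.

(** The mean of the discarded part is bounded by tilting the weight by r. *)
Lemma annealed_le_integral_trunc :
  (annealed%:E <= \int[P]_w (trunc_partition (H w))%:E +
    (annealed * expR (- (n%:R * r ^+ 2 / 2)))%:E)%E.
Proof.
pose F s w := expR (- (r * n%:R * (beta + r))) * expR ((beta + r) * n%:R * H w s).
have F0 s w : 0 <= F s w by rewrite mulr_ge0 ?expR_ge0.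
have mF s : measurable_fun setT (F s).
  by apply: measurable_funM => //; exact: measurable_expR_hamiltonian.
have mw s := measurable_trunc_weight s.
have E1 : annealed%:E = (\int[P]_w (\sum_s expR (beta * n%:R * H w s))%:E)%E.
  rewrite integral_sum_EFin//; last first.
    by move=> s; exact: measurable_expR_hamiltonian.
  under eq_bigr do rewrite integral_expR_hamiltonian//.
  rewrite sumEFin sum_config_cst /annealed; congr (_ * expR _)%:E; ring.
have E2 : (annealed * expR (- (n%:R * r ^+ 2 / 2)))%:E =
    (\int[P]_w (\sum_s F s w)%:E)%E.
  rewrite integral_sum_EFin//.
  under eq_bigr => s _.
    rewrite integral_mulr_EFin//; last exact: measurable_expR_hamiltonian.
    rewrite integral_expR_hamiltonian// -EFinM -expRD.
    over.
  rewrite sumEFin sum_config_cst /annealed -mulrA -expRD.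
  by congr (_ * expR _)%:E; field.
rewrite E1 E2 -integral_add_EFin//.
- apply: ler_integral.
  + by apply: measurable_sum => s; exact: measurable_expR_hamiltonian.
  + by apply: measurable_funD; apply: measurable_sum.
  + by move=> w; apply: sumr_ge0 => s _; exact: expR_ge0.
  + move=> w; rewrite -big_split/=; apply: ler_sum => s _.
    rewrite /trunc_weight; have [h|h] := leP (H w s) (beta + r).
      by rewrite mulr1 lerDl.
    rewrite mulr0 add0r /F -expRD ler_expR.
    have : 0 <= r * n%:R * (H w s - (beta + r)).
      apply: mulr_ge0; last by rewrite subr_ge0 ltW.
      by apply: mulr_ge0 => //; exact: ltW.
    by lra.
- exact: measurable_trunc_partition.
- exact: measurable_sum.
- by move=> w; exact: trunc_partition_ge0.
- by move=> w; exact: sumr_ge0.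
Qed.

Lemma integral_trunc_pair_le s t :
  (\int[P]_w (trunc_weight (H w) s * trunc_weight (H w) t)%:E <=
   (expR (n%:R * beta ^+ 2 * (1 + overlap R s t ^+ p)))%:E)%E.
Proof.
have -> : n%:R * beta ^+ 2 = beta ^+ 2 * n%:R by rewrite mulrC.
rewrite -(integral_expR_hamiltonian_pair n0 iidJ); apply: ler_integral.
- by apply: measurable_funM; exact: measurable_trunc_weight.
- exact: measurable_expR_hamiltonian_pair.
- by move=> w; rewrite mulr_ge0 ?trunc_weight_ge0.
- move=> w; rewrite mulrDr expRD ler_pM ?trunc_weight_ge0//.
    by rewrite ler_piMr ?expR_ge0// lern1 leq_b1.
  by rewrite ler_piMr ?expR_ge0// lern1 leq_b1.
Qed.

(** A bound uniform in the overlap: below the truncation level,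
    expR (beta * n * (h s + h t)) is at most expR (n * beta * (beta + r)) times
    its square root. *)
Lemma integral_trunc_pair_le_near s t :
  (\int[P]_w (trunc_weight (H w) s * trunc_weight (H w) t)%:E <=
   (expR (n%:R * (3 / 2 * beta ^+ 2 + beta * r)))%:E)%E.
Proof.
pose k := expR (n%:R * beta * (beta + r)).
apply: (@le_trans _ _ (\int[P]_w (k *
    expR (beta / 2 * n%:R * (H w s + H w t)))%:E)%E).
  apply: ler_integral.
  - by apply: measurable_funM; exact: measurable_trunc_weight.
  - by apply: measurable_funM => //; exact: measurable_expR_hamiltonian_pair.
  - by move=> w; rewrite mulr_ge0 ?trunc_weight_ge0.
  - move=> w; rewrite /trunc_weight.
    have [hs|hs] := leP (H w s) _; last first.
      by rewrite mulr0 mul0r mulr_ge0 ?expR_ge0.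
    have [ht|ht] := leP (H w t) _; last by rewrite !mulr0 mulr_ge0 ?expR_ge0.
    rewrite !mulr1 -!expRD ler_expR.
    have : 0 <= beta / 2 * n%:R * (beta + r - H w s + (beta + r - H w t)).
      apply: mulr_ge0; last by apply: addr_ge0; rewrite subr_ge0.
      by rewrite mulr_ge0 // divr_ge0 // ltW.
    by lra.
rewrite integral_mulr_EFin//; last 2 first.
- exact: measurable_expR_hamiltonian_pair.
- exact: expR_ge0.
rewrite integral_expR_hamiltonian_pair// -EFinM lee_fin -expRD ler_expR.
have rho1 : overlap R s t ^+ p <= 1.
  apply: le_trans (ler_norm _) _; rewrite normrX exprn_ile1//.
  exact: overlap_le1.
have : 0 <= n%:R * beta ^+ 2 * (1 - overlap R s t ^+ p).
  by rewrite mulr_ge0 ?subr_ge0// mulr_ge0// sqr_ge0.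
by move: (overlap R s t ^+ p) => q h; nra.
Qed.

End truncated_partition_function.

(** * Three rare events *)

Section rare_events.
Local Open Scope classical_set_scope.
Variables (R : realType) (d : measure_display) (T : measurableType d).
Variable P : probability T R.
Variables (n p : nat) (J : {ffun 'I_p -> 'I_n} -> {RV P >-> R}).
Hypothesis n0 : (0 < n)%N.
Hypothesis iidJ : iid_std_normal J.
Local Notation H w := (hamiltonian (fun i => J i w)).
Variables beta r g nu nu1 C : R.
Hypotheses (beta0 : 0 < beta) (r0 : 0 < r) (g0 : 0 < g).
Hypothesis g_le1 : g <= beta ^+ 2 - ln 2.
Hypothesis g_le2 : g <= ln 2 - beta ^+ 2 / 2.
Hypothesis beta_r : beta * r <= g / 4.
Hypothesis nuE : nu = (g / 8) ^+ 2 / 4.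
Hypotheses (nu0 : 0 < nu) (nu_le : nu <= 4^-1).
Hypothesis p8 : (8 <= p)%N.
Hypothesis p_far : beta ^+ 2 * (1 - 2 * nu) ^+ (p - 8) <= 16^-1.
Hypothesis C_overlap : forall s : config n,
  \sum_t expR (n%:R * overlap R s t ^+ 8 / 16) <= 2 ^+ n * (1 + C / n%:R).

Let nn : 0 < n%:R :> R. Proof. by rewrite ltr0n. Qed.

Lemma exp2n_expR : 2 ^+ n = expR (n%:R * ln 2) :> R.
Proof. by rewrite expRM_natl lnK// posrE. Qed.

Lemma overlap_far (s t : config n) : nu * n%:R < (hamming s t)%:R :> R ->
  nu * n%:R < (n - hamming s t)%:R :> R -> `|overlap R s t| <= 1 - 2 * nu.
Proof.
rewrite natrB ?hamming_le// overlapE// => h1 h2.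
have i1 : nu < n%:R^-1 * (hamming s t)%:R by rewrite mulrC ltr_pdivlMr.
have i2 : n%:R^-1 * (hamming s t)%:R < 1 - nu.
  by rewrite mulrC ltr_pdivrMr// mulrBl mul1r; lra.
rewrite ler_norml; lra.
Qed.

Lemma overlap_far_expn (s t : config n) : `|overlap R s t| <= 1 - 2 * nu ->
  beta ^+ 2 * overlap R s t ^+ p <= overlap R s t ^+ 8 / 16.
Proof.
move: (overlap R s t) => x xq.
apply: (@le_trans _ _ (beta ^+ 2 * (`|x| ^+ (p - 8) * x ^+ 8))).
  rewrite ler_wpM2l ?sqr_ge0// -{1}(subnK p8) exprD.
  by rewrite ler_wpM2r ?exprn_even_ge0// -normrX ler_norm.
rewrite mulrA [leRHS]mulrC ler_wpM2r ?exprn_even_ge0//.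
apply: le_trans p_far; rewrite ler_wpM2l ?sqr_ge0// lerXn2r ?nnegrE//.
by apply: le_trans xq.
Qed.

(** The pairs at distance at most nu * n or at least (1 - nu) * n contribute the
    exponentially small term, the other ones 1 + C / n. *)
Lemma integral_trunc_partition_sqr :
  (\int[P]_w (trunc_partition beta r (H w) ^+ 2)%:E <=
   (annealed n beta ^+ 2 * (1 + (C / n%:R + 2 * expR (- (n%:R * g / 2)))))%:E)%E.
Proof.
pose K := expR (n%:R * (3 / 2 * beta ^+ 2 + beta * r)).
pose near1 (s t : config n) := ((hamming s t)%:R <= (g / 8) ^+ 2 / 4 * n%:R :> R)%R.
pose near2 (s t : config n) := ((n - hamming s t)%:R <= (g / 8) ^+ 2 / 4 * n%:R :> R)%R.
pose F (s t : config n) : R := expR (n%:R * beta ^+ 2) * expR (n%:R * overlap R s t ^+ 8 / 16).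
pose bnd (s t : config n) := (if near1 s t then K else 0) + (if near2 s t then K else 0) + F s t.
have F0 s t : 0 <= F s t by rewrite mulr_ge0 ?expR_ge0.
have K0 : 0 <= K by exact: expR_ge0.
have mw s := measurable_trunc_weight J beta r s.
have mww s t : measurable_fun setT
    (fun w => trunc_weight beta r (H w) s * trunc_weight beta r (H w) t).
  exact: measurable_funM.
have ww0 s t w : 0 <= trunc_weight beta r (H w) s * trunc_weight beta r (H w) t.
  by rewrite mulr_ge0 ?trunc_weight_ge0.
have pair s t : (\int[P]_w
    (trunc_weight beta r (H w) s * trunc_weight beta r (H w) t)%:E <=
    (bnd s t)%:E)%E.
  have near : (\int[P]_w
      (trunc_weight beta r (H w) s * trunc_weight beta r (H w) t)%:E <= K%:E)%E.
    exact: integral_trunc_pair_le_near.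
  rewrite /bnd; case: ifPn => h1.
    apply: le_trans near _; rewrite lee_fin -addrA lerDl addr_ge0//.
    by case: ifP.
  rewrite add0r; case: ifPn => h2.
    by apply: le_trans near _; rewrite lee_fin lerDl.
  rewrite add0r; apply: (le_trans (integral_trunc_pair_le n0 iidJ _ _ _ _)).
  rewrite lee_fin /F -expRD ler_expR mulrDr mulr1 lerD2l -[leLHS]mulrA -[leRHS]mulrA ler_pM2l//.
  apply: overlap_far_expn; apply: overlap_far; rewrite ltNge nuE.
    exact: h1.
  exact: h2.
have -> : (\int[P]_w (trunc_partition beta r (H w) ^+ 2)%:E =
    \sum_s \sum_t \int[P]_w
      (trunc_weight beta r (H w) s * trunc_weight beta r (H w) t)%:E)%E.
  transitivity (\int[P]_w (\sum_s \sum_t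
      (trunc_weight beta r (H w) s * trunc_weight beta r (H w) t))%:E)%E.
    apply: eq_integral => w _; congr EFin.
    by rewrite expr2 mulr_suml; apply: eq_bigr => s _; rewrite mulr_sumr.
  rewrite integral_sum_EFin//; last 2 first.
  - by move=> s; exact: measurable_sum.
  - by move=> s w; exact: sumr_ge0.
  by apply: eq_bigr => s _; rewrite integral_sum_EFin.
apply: (@le_trans _ _ (\sum_(s : config n) \sum_(t : config n) (bnd s t)%:E)%E).
  by apply: lee_sum => s _; apply: lee_sum => t _; exact: pair.
under eq_bigr do rewrite sumEFin.
rewrite sumEFin lee_fin.
have psi0 : 0 < g / 8 by rewrite divr_gt0.
have card_if (A : pred (config n)) :
    \sum_t (if A t then K else 0) = #|[pred t | A t]|%:R * K.
  by rewrite -big_mkcond sumr_const -[LHS]mulr_natl.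
pose B := 2 * (expR (g / 8 * n%:R) * K) +
  expR (n%:R * beta ^+ 2) * (2 ^+ n * (1 + C / n%:R)).
apply: (@le_trans _ _ (\sum_(s : config n) B)).
  apply: ler_sum => s _; rewrite /bnd !big_split/= !card_if /B mulr2n mulrDl mul1r.
  rewrite !lerD//.
  - by rewrite ler_wpM2r//; exact: card_hamming_ball.
  - by rewrite ler_wpM2r//; exact: card_hamming_antiball.
  - by rewrite -mulr_sumr ler_wpM2l ?expR_ge0.
rewrite sum_config_cst /B /annealed.
have M2 : (2 ^+ n * expR (n%:R * beta ^+ 2 / 2)) ^+ 2 =
    2 ^+ n * (2 ^+ n * expR (n%:R * beta ^+ 2)).
  rewrite exprMn expr2 -mulrA; congr (_ * (_ * _)).
  by rewrite -expRM_natl; congr expR; field.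
rewrite M2 -[leRHS]mulrA ler_pM2l ?exprn_gt0//.
have key : expR (g / 8 * n%:R) * K <=
    2 ^+ n * expR (n%:R * beta ^+ 2) * expR (- (n%:R * g / 2)).
  rewrite exp2n_expR /K -!expRD ler_expR.
  have : 0 <= n%:R * (ln 2 + beta ^+ 2 - g / 2 - g / 8 -
      (3 / 2 * beta ^+ 2 + beta * r)).
    by rewrite mulr_ge0//; move: g_le2 beta_r g0; lra.
  by lra.
move: key; set X := expR (- _); set Y := expR (n%:R * beta ^+ 2).
set Z := expR (g / 8 * _) * K; set W := C / _; set V := 2 ^+ n.
by move=> key; nra.
Qed.

Lemma probability_trunc_partition_small :
  (P [set w | trunc_partition beta r (H w) < annealed n beta / 2]%R <=
   (4 * (C / n%:R + 2 * expR (- (n%:R * g / 2)) +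
     2 * expR (- (n%:R * r ^+ 2 / 2))))%:E)%E.
Proof.
apply: probability_lt_half.
- exact: measurable_trunc_partition.
- by move=> w; exact: trunc_partition_ge0.
- exact: annealed_gt0.
- exact: annealed_le_integral_trunc.
- exact: integral_trunc_partition_sqr.
Qed.

(** An upper bound for the number of ordered pairs in the energy window whose
    distance lies strictly between nu1 * n and nu * n: for r <= beta each such
    pair contributes at least 1. *)
Definition close_pairs_weight (h : config n -> R) : R :=
  \sum_s \sum_t
    ((nu1 * n%:R < (hamming s t)%:R) && ((hamming s t)%:R < nu * n%:R))%R%:R *
    (expR (- (2 * (beta - r) ^+ 2 * n%:R)) *
     expR ((beta - r) * n%:R * (h s + h t))).

Lemma measurable_close_pairs_weight :
  measurable_fun setT (fun w => close_pairs_weight (H w)).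
Proof.
apply: measurable_sum => s; apply: measurable_sum => t.
apply: measurable_funM => //; apply: measurable_funM => //.
exact: measurable_expR_hamiltonian_pair.
Qed.

Lemma probability_close_pairs : 0 < nu1 ->
  (1 - 2 * nu1) ^+ p <= g / (4 * beta ^+ 2) ->
  (P [set w | 1 <= close_pairs_weight (H w)]%R <= (expR (- (n%:R * g / 8)))%:E)%E.
Proof.
move=> nu10 p_near.
have [[G1 G3] G4] := (g_le1, beta_r, nu_le).
have [[B0 R0] G0'] := (beta0, r0, g0).
have ln2 : 0 < ln (2 : R) by rewrite ln_gt0// ltr1n.
pose b (s t : config n) := (((nu1 * n%:R < (hamming s t)%:R) &&
  ((hamming s t)%:R < nu * n%:R))%R : bool).
pose k := expR (- (2 * (beta - r) ^+ 2 * n%:R)).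
pose G s t w := (b s t)%:R * (k * expR ((beta - r) * n%:R * (H w s + H w t))).
have G0 s t w : 0 <= G s t w by rewrite !mulr_ge0 ?expR_ge0.
have mE s t := measurable_expR_hamiltonian_pair J (beta - r) s t.
have mkE s t : measurable_fun setT
  (fun w => k * expR ((beta - r) * n%:R * (H w s + H w t))) by exact: measurable_funM.
have mG s t : measurable_fun setT (G s t) by exact: measurable_funM.
apply: (@le_trans _ _ (\int[P]_w (close_pairs_weight (H w))%:E)%E).
  apply: probability_le_integral => //.
  - apply: measurable_set_le => //; exact: measurable_close_pairs_weight.
  - exact: measurable_close_pairs_weight.
  - by move=> w; apply: sumr_ge0 => s _; apply: sumr_ge0 => t _; exact: G0.
rewrite (@integral_sum_EFin _ _ _ P _ (fun s w => \sum_t G s t w))//; last 2 first.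
- by move=> s; exact: measurable_sum.
- by move=> s w; exact: sumr_ge0.
have pair s t : (\int[P]_w (G s t w)%:E <=
    ((b s t)%:R * expR (- (n%:R * (ln 2 + g / 4))))%:E)%E.
  rewrite integral_mulr_EFin//; last by move=> w; rewrite mulr_ge0 ?expR_ge0.
  have [/andP[b1 b2]|nb] := boolP (b s t); last by rewrite !mul0e mul0r.
  rewrite mul1e mul1r integral_mulr_EFin//; last exact: expR_ge0.
  rewrite integral_expR_hamiltonian_pair// -EFinM lee_fin -expRD ler_expR.
  have rho : 0 <= overlap R s t <= 1 - 2 * nu1.
    have i1 : nu1 < n%:R^-1 * (hamming s t)%:R by rewrite mulrC ltr_pdivlMr.
    have i2 : n%:R^-1 * (hamming s t)%:R < nu by rewrite mulrC ltr_pdivrMr.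
    by rewrite overlapE//; lra.
  move: rho => /andP[rho0 rho1].
  have rhop : overlap R s t ^+ p <= g / (4 * beta ^+ 2).
    apply: le_trans p_near; rewrite lerXn2r ?nnegrE//; exact: le_trans rho1.
  have rhop0 : 0 <= overlap R s t ^+ p by exact: exprn_ge0.
  move: (overlap R s t ^+ p) rhop rhop0 => x xg x0.
  have bb0 : 0 < beta ^+ 2 by exact: exprn_gt0.
  have xg' : beta ^+ 2 * x <= g / 4.
    by move: xg; rewrite invfM mulrA ler_pdivlMr// mulrC.
  have br2 : (beta - r) ^+ 2 <= beta ^+ 2.
    rewrite -subr_ge0 (_ : _ - _ = 2 * (r * (beta - r)) + r ^+ 2); last by ring.
    have : r <= beta by nra.
    by move=> rb; rewrite addr_ge0 ?sqr_ge0// mulr_ge0// mulr_ge0 ?subr_ge0// ltW.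
  have brx : (beta - r) ^+ 2 * x <= g / 4.
    by apply: le_trans xg'; rewrite ler_wpM2r.
  have brg : ln 2 + g / 2 <= (beta - r) ^+ 2.
    by have := sqr_ge0 r; nra.
  have : 0 <= n%:R * ((beta - r) ^+ 2 - (beta - r) ^+ 2 * x - (ln 2 + g / 4)).
    by rewrite mulr_ge0//; lra.
  by lra.
apply: (@le_trans _ _ (\sum_(s : config n) \sum_(t : config n)
    ((b s t)%:R * expR (- (n%:R * (ln 2 + g / 4))))%:E)%E).
  apply: lee_sum => s _; rewrite integral_sum_EFin//.
  by apply: lee_sum => t _; exact: pair.
under eq_bigr do rewrite sumEFin -mulr_suml.
rewrite sumEFin lee_fin.
apply: (@le_trans _ _ (\sum_(s : config n)
    expR (g / 8 * n%:R) * expR (- (n%:R * (ln 2 + g / 4))))).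
  apply: ler_sum => s _; rewrite ler_wpM2r ?expR_ge0//.
  have psi0 : 0 < g / 8 by rewrite divr_gt0.
  apply: le_trans (card_hamming_ball s psi0).
  rewrite -sum1_card natr_sum [leRHS]big_mkcond/=; apply: ler_sum => t _.
  have [/andP[_ /ltW b2]|nb] := boolP (b s t); last by case: ifP.
  by rewrite inE -nuE b2.
rewrite sum_config_cst exp2n_expR -!expRD ler_expR.
by rewrite le_eqVlt; apply/orP; left; apply/eqP; field.
Qed.

(** An upper bound for the Boltzmann mass outside the energy window: the first
    summand dominates the energies above beta + r, the second one those below
    beta - r. *)
Definition tail_weight (h : config n -> R) : R :=
  \sum_s (expR (- (r * n%:R * (beta + r))) * expR ((beta + r) * n%:R * h s) +
          expR (r * n%:R * (beta - r)) * expR ((beta - r) * n%:R * h s)).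

Lemma measurable_tail_weight : measurable_fun setT (fun w => tail_weight (H w)).
Proof.
apply: measurable_sum => s; apply: measurable_funD;
  by apply: measurable_funM => //; exact: measurable_expR_hamiltonian.
Qed.

Lemma tail_weight_ge (h : config n -> R) :
  \sum_(s | ~~ (`|h s - beta| <= r)) expR (beta * n%:R * h s) <= tail_weight h.
Proof.
rewrite big_mkcond/=; apply: ler_sum => s _.
case: ifPn => [|_]; last by rewrite addr_ge0// mulr_ge0 ?expR_ge0.
rewrite -ltNge ltr_normr => /orP[hs|hs]; last first.
  rewrite -[leLHS]add0r lerD ?mulr_ge0 ?expR_ge0// -expRD ler_expR.
  have : 0 <= n%:R * r * (beta - r - h s).
    by apply: mulr_ge0; [apply: mulr_ge0; exact: ltW|lra].
  by lra.
rewrite -[leLHS]addr0 lerD ?mulr_ge0 ?expR_ge0// -expRD ler_expR.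
have : 0 <= n%:R * r * (h s - (beta + r)).
  by apply: mulr_ge0; [apply: mulr_ge0; exact: ltW|lra].
by lra.
Qed.

Lemma probability_tail_weight :
  (P [set w | annealed n beta * expR (- (n%:R * r ^+ 2 / 4)) <= tail_weight (H w)]%R
   <= (2 * expR (- (n%:R * r ^+ 2 / 4)))%:E)%E.
Proof.
set a := _ * _; have a0 : 0 < a by rewrite mulr_gt0 ?annealed_gt0 ?expR_gt0.
pose F s w := expR (- (r * n%:R * (beta + r))) * expR ((beta + r) * n%:R * H w s).
pose G s w := expR (r * n%:R * (beta - r)) * expR ((beta - r) * n%:R * H w s).
have F0 s w : 0 <= F s w by rewrite mulr_ge0 ?expR_ge0.
have G0 s w : 0 <= G s w by rewrite mulr_ge0 ?expR_ge0.
have mE l s := measurable_expR_hamiltonian J l s.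
have mF s : measurable_fun setT (F s) by exact: measurable_funM.
have mG s : measurable_fun setT (G s) by exact: measurable_funM.
have t0 w : 0 <= tail_weight (H w).
  by apply: sumr_ge0 => s _; rewrite addr_ge0 ?F0 ?G0.
have mt := measurable_tail_weight.
apply: (@le_trans _ _ (\int[P]_w (a^-1 * tail_weight (H w))%:E)%E).
  apply: probability_le_integral => //.
  - exact: measurable_set_le.
  - exact: measurable_funM.
  - by move=> w; rewrite mulr_ge0// invr_ge0 ltW.
  - by move=> w /= aw; rewrite mulrC ler_pdivlMr// mul1r.
rewrite integral_mulr_EFin//; last by rewrite invr_ge0 ltW.
have -> : (\int[P]_w (tail_weight (H w))%:E =
    (2 * (annealed n beta * expR (- (n%:R * r ^+ 2 / 2))))%:E)%E.
  rewrite (@integral_sum_EFin _ _ _ P _ (fun s w => F s w + G s w))//; last 2 first.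
  - by move=> s; exact: measurable_funD.
  - by move=> s w; rewrite addr_ge0.
  rewrite (eq_bigr (fun=> (2 * expR (n%:R * beta ^+ 2 / 2 - n%:R * r ^+ 2 / 2))%:E)).
    by rewrite sumEFin sum_config_cst /annealed -(mulrA (2 ^+ n)) -expRD mulrCA.
  move=> s _; rewrite integral_add_EFin// !integral_mulr_EFin ?expR_ge0//.
  rewrite !integral_expR_hamiltonian// -!EFinM -EFinD -!expRD; congr EFin.
  by rewrite mulr2n mulrDl mul1r; congr (expR _ + expR _); field.
rewrite -EFinM lee_fin mulrCA ler_pM2l// ler_pdivrMl// /a -[leRHS]mulrA -expRD.
rewrite ler_pM2l ?annealed_gt0// ler_expR.
by rewrite le_eqVlt; apply/orP; left; apply/eqP; field.
Qed.

End rare_events.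

(** * Clusters of a set with a gap in its distances *)

Section clusters_from_gap.
Variables (R : realType) (n : nat) (S : {set config n}) (nu1 nu2 : R).
Hypotheses (nu12 : nu1 < 2^-1 * nu2) (nu2_le1 : nu2 <= 1).
Hypothesis n0 : (0 < n)%N.
Hypothesis gap : forall s t, s \in S -> t \in S ->
  nu1 * n%:R < (hamming s t)%:R -> nu2 * n%:R <= (hamming s t)%:R.

(** Two configurations are close when they may belong to the same cluster. *)
Definition close (s t : config n) : bool := (hamming s t)%:R <= nu1 * n%:R.

(** The clusters: the classes of the relation close on S. *)
Definition components : {set {set config n}} :=
  finset.equivalence_partition close S.

(** Transitivity holds because two steps cover less than nu2 * n, so that the
    gap brings the distance back below nu1 * n. *)
Lemma close_equivalence : 0 < nu1 -> {in S & &, equivalence_rel close}.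
Proof.
move=> nu10 s t u sS tS uS.
have nn : 0 < n%:R :> R by rewrite ltr0n.
have trans x y z : x \in S -> z \in S -> close x y -> close y z -> close x z.
  move=> xS zS xy yz; rewrite /close leNgt; apply/negP => /(gap xS zS) xz.
  have tri : (hamming x z)%:R <= (hamming x y)%:R + (hamming y z)%:R :> R.
    by rewrite -natrD ler_nat hamming_triangle.
  have : nu1 * n%:R < 2^-1 * nu2 * n%:R by rewrite ltr_pM2r.
  by move: xy yz; rewrite /close; lra.
split; first by rewrite /close hammingss mulr_ge0// ltW.
move=> st; apply/idP/idP => h; last exact: trans st h.
by apply: trans h => //; rewrite /close hammingC.
Qed.

Lemma components_partition : 0 < nu1 -> finset.partition components S.
Proof. by move=> nu10; apply: finset.equivalence_partitionP; exact: close_equivalence. Qed.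

Lemma components_close A s t : 0 < nu1 ->
  A \in components -> s \in A -> t \in A -> close s t.
Proof.
move=> nu10 AP sA tA; have part := components_partition nu10.
have [_ tiP _] := and3P part.
have sS : s \in S by rewrite -(finset.cover_partition part); apply/finset.bigcupP; exists A.
have tS : t \in S by rewrite -(finset.cover_partition part); apply/finset.bigcupP; exists A.
rewrite -(finset.pblock_equivalence_partition (close_equivalence nu10) sS tS).
by rewrite (finset.def_pblock tiP AP sA).
Qed.

Lemma components_far A B s t : 0 < nu1 -> A \in components -> B \in components ->
  A != B -> s \in A -> t \in B -> nu2 * n%:R <= (hamming s t)%:R.
Proof.
move=> nu10 AP BP AB sA tB; have part := components_partition nu10.
have [_ tiP _] := and3P part.
have sS : s \in S by rewrite -(finset.cover_partition part); apply/finset.bigcupP; exists A.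
have tS : t \in S by rewrite -(finset.cover_partition part); apply/finset.bigcupP; exists B.
apply: gap => //; rewrite ltNge; apply: contraNN AB => st.
have := finset.pblock_equivalence_partition (close_equivalence nu10) sS tS.
rewrite (finset.def_pblock tiP AP sA) /close st => tA.
by rewrite -(finset.def_pblock tiP AP tA) (finset.def_pblock tiP BP tB).
Qed.

Lemma components_clustering : 0 < nu1 -> clustering nu1 nu2 S (enum components).
Proof.
move=> nu10; split.
- split; first exact: enum_uniq.
  by rewrite finset.set_enum; exact: components_partition.
- move=> A; rewrite mem_enum => AP s t sA tA; exact: (components_close nu10 AP sA tA).
- have := enum_uniq (mem components); rewrite uniq_pairwise.
  apply: (@sub_in_pairwise _ (mem components)).
    move=> A B AP BP /= AB; apply/forallP => s; apply/implyP => sA.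
    by apply/forallP => t; apply/implyP => tB; exact: (components_far nu10 AP BP AB sA tB).
  by apply/allP => A; rewrite mem_enum.
Qed.

Lemma components_diam A : 0 < nu1 -> A \in components ->
  (diam A)%:R <= nu1 * n%:R.
Proof.
move=> nu10 AP; rewrite /diam.
have z : 0%:R <= nu1 * n%:R by rewrite mulr_ge0// ltW.
have mx (x y : nat) : x%:R <= nu1 * n%:R -> y%:R <= nu1 * n%:R ->
    (maxn x y)%:R <= nu1 * n%:R by move=> hx hy; rewrite /maxn; case: ifP.
apply: (big_ind (fun m : nat => m%:R <= nu1 * n%:R)) => // s sA.
apply: (big_ind (fun m : nat => m%:R <= nu1 * n%:R)) => // t tA.
exact: (components_close nu10 AP sA tA).
Qed.

Lemma components_dist : 0 < nu1 ->
  pairwise [rel A B : {set config n} | nu2 * n%:R <= (dist A B)%:R]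
    (enum components).
Proof.
move=> nu10.
have z : nu2 * n%:R <= n%:R by rewrite ler_piMl.
have mn (x y : nat) : nu2 * n%:R <= x%:R -> nu2 * n%:R <= y%:R ->
    nu2 * n%:R <= (minn x y)%:R by move=> hx hy; rewrite /minn; case: ifP.
have := enum_uniq (mem components); rewrite uniq_pairwise.
apply: (@sub_in_pairwise _ (mem components)).
  move=> A B AP BP /= AB; rewrite /dist.
  apply: (big_ind (fun m : nat => nu2 * n%:R <= m%:R)) => // s sA.
  apply: (big_ind (fun m : nat => nu2 * n%:R <= m%:R)) => // t tA.
  exact: (components_far nu10 AP BP AB sA tA).
by apply/allP => A; rewrite mem_enum.
Qed.

Lemma components_neq0 A : 0 < nu1 -> A \in components -> A != finset.set0.
Proof.
move=> nu10 AP; have [_ _] := and3P (components_partition nu10).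
by apply: contraNneq => <-.
Qed.

End clusters_from_gap.

Section deterministic_shattering.
Variables (R : realType) (n : nat) (H : config n -> R).
Variables beta r g nu nu1 : R.
Hypotheses (beta0 : 0 < beta) (r0 : 0 < r) (g0 : 0 < g) (n0 : (0 < n)%N).
Hypothesis r_le : r <= beta.
Hypothesis g_le2 : g <= ln 2 - beta ^+ 2 / 2.
Hypothesis beta_r : beta * r <= g / 4.
Hypothesis nuE : nu = (g / 8) ^+ 2 / 4.
Hypotheses (nu10 : 0 < nu1) (nu12 : nu1 < 2^-1 * nu) (nu_le : nu <= 4^-1).
(** The size of the system is large. *)
Hypothesis large_g : 2 <= expR (n%:R * g / 8).
Hypothesis large_r : 4 <= expR (n%:R * r ^+ 2 / 4).
(** The three rare events do not occur. *)
Hypothesis Ztrunc : annealed n beta / 2 <= trunc_partition beta r H.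
Hypothesis no_pairs : close_pairs_weight beta r nu nu1 H < 1.
Hypothesis tail : tail_weight beta r H <
  annealed n beta * expR (- (n%:R * r ^+ 2 / 4)).

Local Notation S := (energy_window H beta r).
Local Notation Z := (partition_function H beta).
Local Notation eps := (2 * expR (- (n%:R * r ^+ 2 / 4))).

Let nn : 0 < n%:R :> R. Proof. by rewrite ltr0n. Qed.

Lemma energy_gap s t : s \in S -> t \in S ->
  nu1 * n%:R < (hamming s t)%:R -> nu * n%:R <= (hamming s t)%:R.
Proof.
rewrite !inE => sS tS h1; rewrite leNgt; apply/negP => h2.
have : 1 <= close_pairs_weight beta r nu nu1 H.
  rewrite /close_pairs_weight (bigD1 s)//= (bigD1 t)//= h1 h2 mul1r.
  rewrite -[leLHS]addr0 lerD//.
    rewrite -[leLHS]addr0 lerD//.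
      rewrite -expRD -[leLHS]expR0 ler_expR.
      move: sS tS; rewrite !ler_norml => /andP[s1 _] /andP[t1 _].
      have : 0 <= (beta - r) * n%:R * ((H s - beta + r) + (H t - beta + r)).
        apply: mulr_ge0; last lra.
        by apply: mulr_ge0; [move: r_le; lra|exact: ltW].
      by lra.
    by apply: sumr_ge0 => u _; rewrite !mulr_ge0 ?expR_ge0.
  by apply: sumr_ge0 => v _; apply: sumr_ge0 => u _; rewrite !mulr_ge0 ?expR_ge0.
by rewrite leNgt no_pairs.
Qed.

Lemma partition_function_ge : annealed n beta / 2 <= Z.
Proof. exact: le_trans Ztrunc (trunc_partition_le _ _ _). Qed.

Lemma partition_function_gt0 : 0 < Z.
Proof.
by apply: lt_le_trans partition_function_ge; rewrite divr_gt0 ?annealed_gt0.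
Qed.

Lemma gibbs_window_ge : 1 - eps <= gibbs H beta S.
Proof.
have Z0 := partition_function_gt0.
rewrite /gibbs -ler_pdivrMl ?invr_gt0// invrK.
have -> : Z = \sum_(s in S) expR (beta * n%:R * H s) +
    \sum_(s | ~~ (`|H s - beta| <= r)) expR (beta * n%:R * H s).
  rewrite /partition_function (bigID (mem S))/=; congr (_ + _).
  by apply: eq_bigl => s; rewrite !inE.
set a := \sum_(s in S) _; set b := \sum_(s | _) _.
have b1 : b <= annealed n beta * expR (- (n%:R * r ^+ 2 / 4)).
  by apply: le_trans (ltW tail); exact: tail_weight_ge.
have ab : annealed n beta / 2 <= a + b.
  apply: (le_trans partition_function_ge).
  rewrite /partition_function (bigID (mem S))/= lerD2l.
  by rewrite le_eqVlt; apply/orP; left; apply/eqP; apply: eq_bigl => s; rewrite !inE.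
have : 0 <= (a + b - annealed n beta / 2) * eps.
  by rewrite mulr_ge0 ?subr_ge0// mulr_ge0 ?expR_ge0.
move: b1; set e := expR _; lra.
Qed.

Lemma gibbs_cluster_le A : A \in components S nu1 ->
  gibbs H beta A <= expR (- (g / 2 * n%:R)).
Proof.
move=> AP; have Z0 := partition_function_gt0.
have [s sA] : exists s, s \in A.
  by apply/finset.set0Pn; exact: (components_neq0 nu12 n0 energy_gap).
have AS t : t \in A -> t \in S.
  move=> tA; rewrite -(finset.cover_partition
    (components_partition nu12 n0 energy_gap nu10)).
  by apply/finset.bigcupP; exists A.
have psi0 : 0 < g / 8 by rewrite divr_gt0.
have card_A : #|A|%:R <= expR (g / 8 * n%:R) :> R.
  apply: le_trans (card_hamming_ball s psi0); rewrite ler_nat.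
  apply/subset_leq_card/fintype.subsetP => t tA; rewrite inE -nuE.
  apply: le_trans (components_close nu12 n0 energy_gap nu10 AP sA tA) _.
  by rewrite ler_pM2r//; move: nu12 nu10; lra.
have sum_A : \sum_(t in A) expR (beta * n%:R * H t) <=
    expR (g / 8 * n%:R) * expR (beta * n%:R * (beta + r)).
  apply: (@le_trans _ _ (\sum_(t in A) expR (beta * n%:R * (beta + r)))).
    apply: ler_sum => t /AS; rewrite inE ler_norml => /andP[_ tr].
    by rewrite ler_expR ler_pM2l ?mulr_gt0//; lra.
  by rewrite sumr_const -[leLHS]mulr_natl ler_wpM2r ?expR_ge0.
rewrite /gibbs ler_pdivrMl//; apply: (le_trans sum_A).
apply: (@le_trans _ _ (annealed n beta / 2 * expR (- (g / 2 * n%:R)))); last first.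
  by rewrite ler_wpM2r ?expR_ge0// partition_function_ge.
rewrite [leRHS]mulrAC ler_pdivlMr// /annealed exp2n_expR -!expRD.
apply: (@le_trans _ _ (expR (g / 8 * n%:R + beta * n%:R * (beta + r)) *
  expR (n%:R * g / 8))).
  by rewrite ler_wpM2l ?expR_ge0.
rewrite -expRD ler_expR.
have : 0 <= n%:R * (ln 2 - beta ^+ 2 / 2 - g * (3 / 4) - beta * r).
  by rewrite mulr_ge0//; move: g_le2 beta_r g0; lra.
by lra.
Qed.

Lemma shattering_of_gap :
  exists C : seq {set config n},
    shattering H beta (2 * nu1) nu (g / (4 * ln 2)) (g / 2) eps C /\
    clustering nu1 nu S C.
Proof.
have ln2 : 0 < ln (2 : R) by rewrite ln_gt0// ltr1n.
have nu1' : nu <= 1 by move: nu_le; lra.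
have part := components_partition nu12 n0 energy_gap nu10.
have [_ tiP _] := and3P part.
have cov : (\bigcup_(A <- enum (components S nu1)) A)%SET = S.
  by rewrite big_enum/= -[RHS](finset.cover_partition part).
exists (enum (components S nu1)); split; last first.
  exact: (components_clustering nu12 n0 energy_gap nu10).
split.
- by move=> A; rewrite mem_enum; exact: (components_neq0 nu12 n0 energy_gap).
- have size_ge : expR (n%:R * g / 4) <= (size (enum (components S nu1)))%:R :> R.
    have : 2^-1 <= gibbs H beta S.
      apply: le_trans gibbs_window_ge.
      have : eps <= 2^-1.
        by rewrite expRN ler_pdivrMr ?expR_gt0//; move: large_r; lra.
      by lra.
    have -> : gibbs H beta S = \sum_(A in components S nu1) gibbs H beta A.
      rewrite /gibbs -mulr_sumr -(finset.big_trivIset _ tiP).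
      by rewrite (finset.cover_partition part).
    move=> half.
    have : 2^-1 <= #|components S nu1|%:R * expR (- (g / 2 * n%:R)).
      apply: (le_trans half); rewrite mulr_natl -sumr_const.
      by apply: ler_sum => A; exact: gibbs_cluster_le.
    rewrite expRN ler_pdivlMr ?expR_gt0// -cardE; apply: le_trans.
    rewrite (_ : g / 2 * n%:R = n%:R * g / 4 + (n%:R * g / 8 + n%:R * g / 8));
      last by field.
    rewrite 2!expRD [leRHS]mulrCA -[leLHS]mulr1 ler_wpM2l ?expR_ge0//.
    by move: large_g; set E := expR _; nra.
  rewrite ler_pdivlMl// ler_pdivlMr//.
  have -> : n%:R * (g / (4 * ln 2)) * ln 2 = n%:R * g / 4 :> R.
    by field; rewrite gt_eqF.
  rewrite -[leLHS]expRK ler_ln ?posrE ?expR_gt0//.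
  exact: lt_le_trans (expR_gt0 _) size_ge.
- split; last exact: (components_dist nu12 nu1' n0 energy_gap nu10).
  move=> A; rewrite mem_enum => AP.
  apply: (le_trans (components_diam nu12 n0 energy_gap nu10 AP)).
  by rewrite ler_wpM2r//; move: nu10; lra.
- by move=> A; rewrite mem_enum; exact: gibbs_cluster_le.
- by rewrite cov; exact: gibbs_window_ge.
Qed.

End deterministic_shattering.

(** * Measurability of the shattering event *)

Section measurability.
Local Open Scope classical_set_scope.
Variables (R : realType) (d : measure_display) (T : measurableType d).

Lemma measurable_set_cst (Q : Prop) : measurable [set w : T | Q].
Proof.
have [q|q] := pselect Q.
  by rewrite (_ : [set _ | _] = setT)//; apply/seteqP; split.
by rewrite (_ : [set _ | _] = set0)//; apply/seteqP; split.
Qed.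

Lemma measurable_set_forall (I : finType) (F : I -> T -> Prop) :
  (forall i, measurable [set w | F i w]) -> measurable [set w | forall i, F i w].
Proof.
move=> mF.
rewrite (_ : [set w | _] = \bigcap_(i in [set: I]) [set w | F i w]).
  by apply: fin_bigcap_measurable => // i _; exact: mF.
by apply/seteqP; split => [w h i _|w h i]; [exact: h|exact: h].
Qed.

Lemma measurable_set_exists (I : countType) (F : I -> T -> Prop) :
  (forall i, measurable [set w | F i w]) -> measurable [set w | exists i, F i w].
Proof.
move=> mF.
rewrite (_ : [set w | _] = \bigcup_i [set w | F i w]).
  by apply: countable_bigcupT_measurable => //; exact: countableP.
by apply/seteqP; split => [w [i h]|w [i _ h]]; exists i.
Qed.

Variables (n : nat) (H : T -> config n -> R).
Hypothesis mH : forall s, measurable_fun setT (fun w => H w s).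
Variable beta : R.

Lemma measurable_boltzmann s :
  measurable_fun setT (fun w => expR (beta * n%:R * H w s)).
Proof. by apply: measurableT_comp => //; exact: measurable_funM. Qed.

Lemma partition_function_pos w : 0 < partition_function (H w) beta.
Proof.
rewrite /partition_function (bigD1 [ffun=> true])//= ltr_pwDl ?expR_gt0//.
by apply: sumr_ge0 => s _; exact: expR_ge0.
Qed.

Lemma measurable_gibbs_le A (x : R) : measurable [set w | gibbs (H w) beta A <= x].
Proof.
rewrite (_ : [set w | _] = [set w | \sum_(s in A) expR (beta * n%:R * H w s) <=
    partition_function (H w) beta * x]).
  apply: measurable_set_le; last apply: measurable_funM => //.
    by under eq_fun do rewrite big_mkcond; apply: measurable_sum => s;
      case: (s \in A) => //; exact: measurable_boltzmann.
  by apply: measurable_sum => s; exact: measurable_boltzmann.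
by apply/seteqP; split => w /=; rewrite /gibbs ler_pdivrMl ?partition_function_pos.
Qed.

Lemma measurable_gibbs_ge A (x : R) : measurable [set w | x <= gibbs (H w) beta A].
Proof.
rewrite (_ : [set w | _] = [set w | partition_function (H w) beta * x <=
    \sum_(s in A) expR (beta * n%:R * H w s)]).
  apply: measurable_set_le; first apply: measurable_funM => //.
    by apply: measurable_sum => s; exact: measurable_boltzmann.
  by under eq_fun do rewrite big_mkcond; apply: measurable_sum => s;
    case: (s \in A) => //; exact: measurable_boltzmann.
by apply/seteqP; split => w /=; rewrite /gibbs ler_pdivlMl ?partition_function_pos.
Qed.

Lemma measurable_energy_window_eq (r : R) (S : {set config n}) :
  measurable [set w | energy_window (H w) beta r = S].
Proof.
rewrite (_ : [set w | _] = [set w | forall s, (`|H w s - beta| <= r) = (s \in S)]).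
  apply: measurable_set_forall => s.
  have m : measurable [set w | `|H w s - beta| <= r].
    apply: measurable_set_le => //; apply: measurableT_comp => //.
    exact: measurable_funB.
  case: (s \in S).
    by rewrite (_ : [set w | _] = [set w | `|H w s - beta| <= r]).
  rewrite (_ : [set w | _] = ~` [set w | `|H w s - beta| <= r]).
    exact: measurableC.
  by apply/seteqP; split => w /= => [->//|/negP/negbTE].
apply/seteqP; split => w /= => [<- s|h]; first by rewrite inE.
by apply/setP => s; rewrite inE.
Qed.

(** The union over all families C is countable, and the energy window takes
    finitely many values. *)
Lemma measurable_shattering_clustering (r a b c c' e nu1 nu2 : R) :
  measurable [set w | exists C : seq {set config n},
    shattering (H w) beta a b c c' e C /\
    clustering nu1 nu2 (energy_window (H w) beta r) C].
Proof.
apply: measurable_set_exists => C.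
have mS : measurable [set w | shattering (H w) beta a b c c' e C].
  rewrite (_ : [set w | _] =
    [set w : T | [/\ forall A, A \in C -> A != finset.set0,
      n%:R^-1 * (ln (size C)%:R / ln 2) >= c &
      (forall A, A \in C -> (diam A)%:R <= a * n%:R) /\
      pairwise [rel A B | b * n%:R <= (dist A B)%:R] C]] `&`
    ([set w | forall A, A \in C -> gibbs (H w) beta A <= expR (- (c' * n%:R))] `&`
     [set w | 1 - e <= gibbs (H w) beta (\bigcup_(A <- C) A)%SET])).
    apply: measurableI; first exact: measurable_set_cst.
    apply: measurableI; last exact: measurable_gibbs_ge.
    apply: measurable_set_forall => A; have [AC|AC] := boolP (A \in C).
      rewrite (_ : [set w | _] = [set w | gibbs (H w) beta A <= expR (- (c' * n%:R))]).
        exact: measurable_gibbs_le.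
      by apply/seteqP; split => w /= h; [exact: h|move=> _; exact: h].
    rewrite (_ : [set w | _] = setT)//.
    by apply/seteqP; split.
  by apply/seteqP; split => w /= => [[]|[[? ? ?] []]].
have mC : measurable [set w | clustering nu1 nu2 (energy_window (H w) beta r) C].
  rewrite (_ : [set w | _] = [set w | exists S : {set config n},
    energy_window (H w) beta r = S /\ clustering nu1 nu2 S C]).
    apply: measurable_set_exists => S.
    exact: (measurableI _ _ (measurable_energy_window_eq r S) (measurable_set_cst _)).
  apply/seteqP; split => w /= => [h|[S [->]]//].
  by exists (energy_window (H w) beta r).
exact: (measurableI _ _ mS mC).
Qed.

End measurability.

(** * Shattering with high probability *)

Section limits.
Local Open Scope classical_set_scope.
Variable R : realType.

Lemma expRN_le_inv (a : R) n : 0 < a -> (0 < n)%N ->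
  expR (- (n%:R * a)) <= a^-1 / n%:R.
Proof.
move=> a0 n0; have nn : 0 < n%:R :> R by rewrite ltr0n.
rewrite expRN -invfM lef_pV2 ?posrE ?expR_gt0 ?mulr_gt0// mulrC.
by apply: le_trans (expR_ge1Dx _); rewrite lerDr.
Qed.

Lemma cvg_le_inv (u : nat -> R) (C : R) :
  (\forall n \near \oo, 0 <= u n <= C / n%:R) -> u n @[n --> \oo] --> (0 : R).
Proof.
move=> h.
have C0 : C / n%:R @[n --> \oo] --> (0 : R).
  rewrite -[0](mulr0 C); apply: cvgM; first exact: cvg_cst.
  apply/gtr0_cvgV0; last exact: cvgr_idn.
  by near=> n; rewrite ltr0n; near: n; exact: nbhs_infty_gt.
apply: (squeeze_cvgr h) C0; exact: cvg_cst.
Unshelve. all: by end_near. Qed.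

Lemma expn_le_eventually (q e : R) : 0 <= q < 1 -> 0 < e ->
  exists N, forall k, (N <= k)%N -> q ^+ k <= e.
Proof.
move=> /andP[q0 q1] e0.
have : q ^+ n @[n --> \oo] --> (0 : R) by apply: cvg_expr; rewrite ger0_norm.
move=> /cvgr0Pnorm_le /(_ e e0)[N _ h]; exists N => k Nk.
by have := h k Nk; rewrite /= ger0_norm// exprn_ge0.
Qed.

End limits.

Section high_probability.
Local Open Scope classical_set_scope.
Variables (R : realType) (d : measure_display) (T : measurableType d).
Variable P : probability T R.

Lemma cvg_probability1 (E : nat -> set T) (C : R) :
  (forall n, measurable (E n)) ->
  (\forall n \near \oo, (P (~` E n) <= (C / n%:R)%:E)%E) ->
  P (E n) @[n --> \oo] --> 1%E.
Proof.
move=> mE h.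
have fin A : measurable A -> P A \is a fin_num by exact: fin_num_measure.
have PE n : fine (P (E n)) = 1 - fine (P (~` E n)).
  rewrite -[E n in LHS]setCK probability_setC; last exact: measurableC.
  by rewrite fineB ?fin//; exact: measurableC.
apply/fine_cvgP; split; first by apply: nearW => n; exact: fin.
rewrite (_ : fine \o _ = fun n => 1 - fine (P (~` E n))); last first.
  by apply/funext => n /=.
rewrite -[X in _ --> X]subr0; apply: cvgB; first exact: cvg_cst.
apply: (@cvg_le_inv _ _ C); near=> n.
rewrite fine_ge0//= -lee_fin fineK ?fin//; last exact: measurableC.
by near: n.
Unshelve. all: by end_near. Qed.

Variables (p : nat) (J : forall n, {ffun 'I_p -> 'I_n} -> {RV P >-> R}).
Hypothesis iidJ : forall n, iid_std_normal (@J n).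
Local Notation H n w := (hamiltonian (fun i => @J n i w)).
Variables beta r g nu nu1 : R.
Hypotheses (beta0 : 0 < beta) (r0 : 0 < r) (g0 : 0 < g).
Hypothesis r_le : r <= beta.
Hypothesis g_le1 : g <= beta ^+ 2 - ln 2.
Hypothesis g_le2 : g <= ln 2 - beta ^+ 2 / 2.
Hypothesis beta_r : beta * r <= g / 4.
Hypothesis nuE : nu = (g / 8) ^+ 2 / 4.
Hypotheses (nu10 : 0 < nu1) (nu12 : nu1 < 2^-1 * nu) (nu_le : nu <= 4^-1).
Hypothesis p8 : (8 <= p)%N.
Hypothesis p_far : beta ^+ 2 * (1 - 2 * nu) ^+ (p - 8) <= 16^-1.
Hypothesis p_near : (1 - 2 * nu1) ^+ p <= g / (4 * beta ^+ 2).

(* The Gibbs mass which may be left outside the clusters. *)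
Local Notation eps n := (2 * expR (- (n%:R * r ^+ 2 / 4))).

(** The event that suitable clusters exist for the system of size n. *)
Definition shattered_event n : set T := [set w | exists C : seq {set config n},
  shattering (H n w) beta (2 * nu1) nu (g / (4 * ln 2)) (g / 2) (eps n) C /\
  clustering nu1 nu (energy_window (H n w) beta r) C].

Lemma measurable_shattered_event n : measurable (shattered_event n).
Proof.
apply: measurable_shattering_clustering => s; exact: measurable_hamiltonian.
Qed.

(** All the error terms are O(1 / n). *)
Lemma probability_not_shattered : exists C : R,
  \forall n \near \oo, (P (~` shattered_event n) <= (C / n%:R)%:E)%E.
Proof.
have [C C0 HC] := sum_expR_overlap8_le R.
have nu0 : 0 < nu by move: nu10 nu12; lra.
have r2 : 0 < r ^+ 2 by exact: exprn_gt0.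
exists (4 * (C + 2 * (g / 2)^-1 + 2 * (r ^+ 2 / 2)^-1) +
  ((g / 8)^-1 + 2 * (r ^+ 2 / 4)^-1)).
near=> n.
have n0 : (0 < n)%N by near: n; exact: nbhs_infty_gt.
have nn : 0 < n%:R :> R by rewrite ltr0n.
have large_g : 2 <= expR (n%:R * g / 8).
  apply: le_trans (expR_ge1Dx _).
  have : 8 / g <= n%:R by near: n; exact: nbhs_infty_ger.
  by rewrite ler_pdivrMr//; lra.
have large_r : 4 <= expR (n%:R * r ^+ 2 / 4).
  apply: le_trans (expR_ge1Dx _).
  have : 12 / r ^+ 2 <= n%:R by near: n; exact: nbhs_infty_ger.
  by rewrite ler_pdivrMr//; lra.
pose B1 := [set w | trunc_partition beta r (H n w) < annealed n beta / 2].
pose B2 := [set w | 1 <= close_pairs_weight beta r nu nu1 (H n w)].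
pose B3 := [set w | annealed n beta * expR (- (n%:R * r ^+ 2 / 4)) <=
  tail_weight beta r (H n w)].
have mB1 : measurable B1.
  by apply: measurable_set_lt => //; exact: measurable_trunc_partition.
have mB2 : measurable B2.
  by apply: measurable_set_le => //; exact: measurable_close_pairs_weight.
have mB3 : measurable B3.
  by apply: measurable_set_le => //; exact: measurable_tail_weight.
have sub : ~` shattered_event n `<=` B1 `|` (B2 `|` B3).
  move=> w; apply: contra_notP => nB; rewrite /shattered_event /=.
  apply: shattering_of_gap => //.
  - by rewrite leNgt; apply/negP => h; apply: nB; left.
  - by rewrite ltNge; apply/negP => h; apply: nB; right; left.
  - by rewrite ltNge; apply/negP => h; apply: nB; right; right.
have P1 : (P B1 <= (4 * (C / n%:R + 2 * expR (- (n%:R * g / 2)) +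
    2 * expR (- (n%:R * r ^+ 2 / 2))))%:E)%E.
  by apply: (@probability_trunc_partition_small _ _ _ _ _ _ _ _ _ _ _ g nu) => // s;
    exact: HC.
have P2 : (P B2 <= (expR (- (n%:R * g / 8)))%:E)%E.
  exact: probability_close_pairs.
have P3 : (P B3 <= (2 * expR (- (n%:R * r ^+ 2 / 4)))%:E)%E.
  exact: probability_tail_weight.
apply: (@le_trans _ _ (P (B1 `|` (B2 `|` B3)))).
  apply: le_measure; rewrite ?inE//; last by do 2 apply: measurableU => //.
  exact/measurableC/measurable_shattered_event.
apply: (@le_trans _ _ (P B1 + (P B2 + P B3))%E).
  apply: (le_trans (measureU2 _ _ _)) => //; first exact: measurableU.
  by rewrite leeD2l//; exact: measureU2.
apply: (le_trans (leeD P1 (leeD P2 P3))); rewrite -!EFinD lee_fin.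
have e1 := @expRN_le_inv R (g / 2) n (divr_gt0 g0 (ltr0n _ 2)) n0.
have e2 := @expRN_le_inv R (g / 8) n (divr_gt0 g0 (ltr0n _ 8)) n0.
have e3 := @expRN_le_inv R (r ^+ 2 / 2) n (divr_gt0 r2 (ltr0n _ 2)) n0.
have e4 := @expRN_le_inv R (r ^+ 2 / 4) n (divr_gt0 r2 (ltr0n _ 4)) n0.
rewrite ![n%:R * (_ / _)]mulrA in e1 e2 e3 e4.
move: e1 e2 e3 e4; set a1 := (g / 2)^-1; set a2 := (g / 8)^-1.
set a3 := (r ^+ 2 / 2)^-1; set a4 := (r ^+ 2 / 4)^-1.
by move: (n%:R^-1) => m; lra.
Unshelve. all: by end_near. Qed.

Lemma shattered_with_high_probability :
  shattered_such_that (@J) beta (2 * nu1) nu (g / (4 * ln 2)) (g / 2)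
    (fun n H C => clustering nu1 nu (energy_window H beta r) C).
Proof.
exists (fun n => eps n).
  apply: (@cvg_le_inv _ _ (2 * (r ^+ 2 / 4)^-1)); near=> n.
  have n0 : (0 < n)%N by near: n; exact: nbhs_infty_gt.
  rewrite mulr_ge0 ?expR_ge0//= -[leRHS]mulrA ler_pM2l// -(mulrA n%:R).
  by apply: expRN_le_inv => //; rewrite divr_gt0// exprn_gt0.
split; first exact: measurable_shattered_event.
have [C HC] := probability_not_shattered.
exact: (cvg_probability1 measurable_shattered_event HC).
Unshelve. all: by end_near. Qed.

End high_probability.

Theorem theorem2p9 (R : realType) (beta : R)
    (hbeta : Num.sqrt (ln 2) < beta < Num.sqrt (2 * ln 2)) :
  exists2 kappa0 : R, 0 < kappa0 &
  forall kappa : R, 0 < kappa < kappa0 ->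
  exists (Pstar : nat) (nu1 nu2 c c' : R),
    [/\ 0 < nu1, nu1 < 2^-1 * nu2, 2^-1 * nu2 < nu2, nu2 < 1 & 0 < c /\ 0 < c'] /\
    forall p : nat, (2 <= p)%N -> (Pstar <= p)%N ->
    forall (d : measure_display) (T : measurableType d) (P : probability T R)
      (J : forall n : nat, {ffun 'I_p -> 'I_n} -> {RV P >-> R}),
    (forall n : nat, iid_std_normal (J n)) ->
    shattered_such_that J beta (2 * nu1) nu2 c c'
      (fun n H C => clustering nu1 nu2
        (energy_window H beta (kappa * Num.sqrt (2 * ln 2))) C).
Proof.
move: hbeta => /andP[hb1 hb2].
have ln2 : 0 < ln (2 : R) by rewrite ln_gt0// ltr1n.
have ln2_le1 : ln (2 : R) <= 1.
  by rewrite -[leRHS]expRK ler_ln ?posrE ?expR_gt0//; exact: expR_ge1Dx.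
have beta0 : 0 < beta by apply: le_lt_trans hb1; exact: sqrtr_ge0.
have b1 : ln 2 < beta ^+ 2.
  by rewrite -[ltLHS]sqr_sqrtr ?ltW// ltr_pXn2r ?nnegrE ?sqrtr_ge0// ltW.
have b2 : beta ^+ 2 < 2 * ln 2.
  by rewrite -[ltRHS]sqr_sqrtr ?mulr_ge0 ?(ltW ln2)//
    ltr_pXn2r ?nnegrE ?sqrtr_ge0 ?(ltW beta0).
pose g : R := Num.min (beta ^+ 2 - ln 2) (ln 2 - beta ^+ 2 / 2).
have g0 : 0 < g by rewrite lt_min; apply/andP; split; lra.
have g1 : g <= beta ^+ 2 - ln 2 by rewrite ge_min lexx.
have g2 : g <= ln 2 - beta ^+ 2 / 2 by rewrite ge_min lexx orbT.
have s0 : 0 < Num.sqrt (2 * ln 2) :> R by rewrite sqrtr_gt0 mulr_gt0.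
exists (g / (4 * beta) / Num.sqrt (2 * ln 2)).
  by rewrite !divr_gt0// mulr_gt0.
move=> kappa /andP[k0 k1].
set r := kappa * _.
have r0 : 0 < r by rewrite mulr_gt0.
have rg : beta * r <= g / 4.
  move: k1; rewrite ltr_pdivlMr// -/r => /ltW.
  by rewrite ler_pdivlMr ?mulr_gt0//; lra.
have r_le : r <= beta by rewrite -(ler_pM2l beta0); nra.
pose nu : R := (g / 8) ^+ 2 / 4.
have g_le1 : g <= 1 by have := sqr_ge0 beta; lra.
have nu0 : 0 < nu by rewrite divr_gt0// exprn_gt0// divr_gt0.
have nu_le : nu <= 4^-1 by rewrite /nu; nra.
have q_bd (x : R) : 0 < x -> x <= 4^-1 -> 0 <= 1 - 2 * x < 1.
  by move=> *; apply/andP; split; lra.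
have b20 : 0 < beta ^+ 2 by exact: exprn_gt0.
(* N1 makes the far pairs negligible in the second moment, N2 makes the
   energies at distance between nu * n / 4 and nu * n nearly independent. *)
have [N1 h1] : exists N, forall k, (N <= k)%N ->
    (1 - 2 * nu) ^+ k <= 16^-1 / beta ^+ 2.
  by apply: expn_le_eventually; [exact: q_bd|rewrite divr_gt0].
have [N2 h2] : exists N, forall k, (N <= k)%N ->
    (1 - 2 * (nu / 4)) ^+ k <= g / (4 * beta ^+ 2).
  by apply: expn_le_eventually; [apply: q_bd; lra|rewrite divr_gt0// mulr_gt0].
exists (8 + N1 + N2)%N, (nu / 4), nu, (g / (4 * ln 2)), (g / 2); split.
  by split; try lra; split; rewrite !divr_gt0// mulr_gt0.
move=> p _ pN d T P J iidJ.
have p8 : (8 <= p)%N by apply: leq_trans pN; rewrite -addnA leq_addr.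
have pN1 : (N1 <= p - 8)%N.
  by rewrite leq_subRL//; apply: leq_trans pN; rewrite leq_addr.
have pN2 : (N2 <= p)%N by apply: leq_trans pN; rewrite leq_addl.
apply: shattered_with_high_probability => //; try lra.
- by move: (h1 _ pN1); rewrite ler_pdivlMr// mulrC.
- exact: h2.
Qed.
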